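(* Every simple weight $U$-module with finite-dimensional weight spaces is (up to isomorphism) of one of the following types: (1) a dense $\mathfrak{sl}_2$-module; (2) a highest weight $U$-module; (3) a lowest weight $U$-module; (4) a module $B^{(q)}_x(N(\lambda,c))$ for some $\lambda\in-\frac12+\mathbb{N}$, $c\in\mathbb{C}\setminus\{0\}$ and $x\in\mathbb{C}$ with $x\ne0$ and $0\le\operatorname{Re}(x)<1$.
   Context: $\mathbb{N}$ denotes the set of nonnegative integers. The Schrödinger algebra $\mathcal{S}$ is the complex Lie algebra with basis $\{f,q,h,z,p,e\}$ and Lie bracket determined by $[h,e]=2e$, $[h,p]=p$, $[h,f]=-2f$, $[e,q]=p$, $[e,p]=0$, $[e,f]=h$, $[p,f]=-q$, $[f,q]=0$, $[h,q]=-q$, $[p,q]=z$, $[z,\mathcal{S}]=0$. $U$ is its universal enveloping algebra. A weight module is a $U$-module that is a direct sum of simultaneous eigenspaces (weight spaces) of $h$ and $z$. On a simple weight module $z$ acts as a scalar, so weight spaces are the $h$-eigenspaces $V_\lambda$; $\operatorname{supp}(V)$ is the set of $h$-eigenvalues (weights). Weights are partially ordered by $\lambda_1\le\lambda_2$ iff $\lambda_2-\lambda_1\in\mathbb{N}$; a highest weight is a maximal element $\lambda$ of $\operatorname{supp}(V)$, vectors in $V_\lambda$ are then highest weight vectors, and a highest weight module is a module generated by a highest weight vector; lowest weights, lowest weight vectors and lowest weight modules are defined analogously. $U$-modules on which $p$ and $q$ (hence $z$) act as $0$ are the same as modules over the $\mathfrak{sl}_2$ spanned by $e,f,h$. A dense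 $\mathfrak{sl}_2$-module is here a simple weight module of this kind with $\operatorname{supp}(V)=\mu+2\mathbb{Z}$ for some $\mu\in\mathbb{C}$. $B^{(q)}_x(N(\lambda,c))$ is the $U$-module with basis $\{v_{i,j}\}_{i,j\in\mathbb{Z},\,0\le j\le\lambda+\frac12}$ and action $q v_{i,j}=v_{i+1,j}$; $f v_{i,j}=v_{i,j+1}$ if $j<\lambda+\frac12$, and $f v_{i,j}=-\sum_{s=0}^{\lambda+\frac12}\frac{1}{(2c)^{\lambda+\frac32-s}}\binom{\lambda+\frac32}{s}v_{i+2\lambda+3-2s,\,s}$ if $j=\lambda+\frac12$; $z v_{i,j}=c\,v_{i,j}$; $h v_{i,j}=(\lambda-(i+x)-2j)v_{i,j}$; $p v_{i,j}=-j\,v_{i+1,j-1}+c(i+x)v_{i-1,j}$; $e v_{i,j}=j(\lambda+1-(i+x)-j)v_{i,j-1}+\frac12c(i+x)((i+x)-1)v_{i-2,j}$ (terms $v_{i',-1}$ occur only with coefficient $0$ and are read as $0$). *)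

(* Defs.v *)
(* MathComp world; the complex numbers are R[i] for R : realType. *)
From mathcomp Require Import all_boot all_order all_algebra.
From mathcomp Require Import complex.
From mathcomp Require Import classical_sets reals.
From mathcomp Require Import ring.

Set Implicit Arguments.
Unset Strict Implicit.
Unset Printing Implicit Defensive.

Import Order.TTheory GRing.Theory Num.Theory.
Local Open Scope ring_scope.
Local Open Scope classical_set_scope.

(* Row vectors of length 6 hold coordinates in the ordered basis
   f, q, h, z, p, e. *)
Notation schr R := 'rV[R[i]]_6.

Definition mk_schr (R : realType) (cf cq ch cz cp ce : R[i]) : schr R :=
  \row_(k < 6) nth 0 [:: cf; cq; ch; cz; cp; ce] k.

Definition cf (R : realType) (a : schr R) : R[i] := a 0 (@Ordinal 6 0 isT).
Definition cq (R : realType) (a : schr R) : R[i] := a 0 (@Ordinal 6 1 isT).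
Definition ch (R : realType) (a : schr R) : R[i] := a 0 (@Ordinal 6 2 isT).
Definition cz (R : realType) (a : schr R) : R[i] := a 0 (@Ordinal 6 3 isT).
Definition cp (R : realType) (a : schr R) : R[i] := a 0 (@Ordinal 6 4 isT).
Definition ce (R : realType) (a : schr R) : R[i] := a 0 (@Ordinal 6 5 isT).

Definition sf (R : realType) : schr R := mk_schr 1 0 0 0 0 0.
Definition sq (R : realType) : schr R := mk_schr 0 1 0 0 0 0.
Definition sh (R : realType) : schr R := mk_schr 0 0 1 0 0 0.
Definition sz (R : realType) : schr R := mk_schr 0 0 0 1 0 0.
Definition sp (R : realType) : schr R := mk_schr 0 0 0 0 1 0.
Definition se (R : realType) : schr R := mk_schr 0 0 0 0 0 1.

(* The bilinear extension of the bracket table, in coordinates; the table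
   itself is recovered in [schr_table] below. *)
Definition schr_bracket (R : realType) (a b : schr R) : schr R :=
  mk_schr
    (- 2 * (ch a * cf b - cf a * ch b))
    ((cf a * cp b - cp a * cf b) + (cq a * ch b - ch a * cq b))
    (ce a * cf b - cf a * ce b)
    (cp a * cq b - cq a * cp b)
    ((ch a * cp b - cp a * ch b) + (ce a * cq b - cq a * ce b))
    (2 * (ch a * ce b - ce a * ch b)).

Notation "[< a , b >]" := (schr_bracket a b)
  (at level 0, a at level 99, b at level 99, format "[<  a ,  b  >]").

Lemma schr_table (R : realType) :
  [/\ [< sh R, se R >] = 2 *: se R, [< sh R, sp R >] = sp R,
      [< sh R, sf R >] = - 2 *: sf R, [< se R, sq R >] = sp R
    & [< se R, sp R >] = 0] /\
  [/\ [< se R, sf R >] = sh R, [< sp R, sf R >] = - sq R,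
      [< sf R, sq R >] = 0, [< sh R, sq R >] = - sq R
    & [< sp R, sq R >] = sz R] /\
  forall a : schr R, [< sz R, a >] = 0.
Proof.
by do ![split]; try move=> a; apply/rowP; case=> [[|[|[|[|[|[|//]]]]]] ltk];
  rewrite /schr_bracket /cf /cq /ch /cz /cp /ce !mxE /=; ring.
Qed.

Lemma schr_bracketxx (R : realType) (a : schr R) : [< a, a >] = 0.
Proof.
by apply/rowP; case=> [[|[|[|[|[|[|//]]]]]] ltk];
  rewrite /schr_bracket !mxE /=; ring.
Qed.

Lemma schr_jacobi (R : realType) (a b c : schr R) :
  [< a, [< b, c >] >] + [< b, [< c, a >] >] + [< c, [< a, b >] >] = 0.
Proof.
by apply/rowP; case=> [[|[|[|[|[|[|//]]]]]] ltk];
  rewrite /schr_bracket /cf /cq /ch /cz /cp /ce !mxE /=; ring.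
Qed.

(* Modules over the universal enveloping algebra U of the Schrodinger algebra
   are the representations of the latter. *)
Definition is_Umodule (R : realType) (V : lmodType R[i])
    (act : schr R -> V -> V) : Prop :=
  [/\ forall a, linear (act a),
      forall v, linear (fun a => act a v)
    & forall a b v, act [< a, b >] v = act a (act b v) - act b (act a v)].

Definition is_submodule (R : realType) (V : lmodType R[i])
    (act : schr R -> V -> V) (W : set V) : Prop :=
  [/\ W 0,
      forall (k : R[i]) u v, W u -> W v -> W (k *: u + v)
    & forall a v, W v -> W (act a v)].

Definition is_simple (R : realType) (V : lmodType R[i])
    (act : schr R -> V -> V) : Prop :=
  (exists v : V, v != 0) /\
  forall W : set V, is_submodule act W -> W = [set 0] \/ W = setT.

Definition generated_by (R : realType) (V : lmodType R[i])
    (act : schr R -> V -> V) (v : V) : Prop :=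
  forall W : set V, is_submodule act W -> W v -> W = setT.

(* Internal direct sum of a family of subspaces. *)
Definition is_direct_sum (K : fieldType) (V : lmodType K) (I : eqType)
    (W : I -> set V) : Prop :=
  (forall v : V, exists (s : seq I) (w : I -> V),
     [/\ uniq s, forall i, W i (w i) & v = \sum_(i <- s) w i]) /\
  (forall (s : seq I) (w : I -> V), uniq s -> (forall i, W i (w i)) ->
     \sum_(i <- s) w i = 0 -> forall i, i \in s -> w i = 0).

Definition is_fin_dim (K : fieldType) (V : lmodType K) (W : set V) : Prop :=
  exists (m : nat) (b : 'I_m -> V), (forall i, W (b i)) /\
    forall v, W v -> exists k : 'I_m -> K, v = \sum_i k i *: b i.

Definition is_basis (K : fieldType) (V : lmodType K) (I : eqType)
    (b : I -> V) : Prop :=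
  (forall v : V, exists (s : seq I) (k : I -> K),
     v = \sum_(i <- s) k i *: b i) /\
  (forall (s : seq I) (k : I -> K), uniq s ->
     \sum_(i <- s) k i *: b i = 0 -> forall i, i \in s -> k i = 0).

Definition hz_space (R : realType) (V : lmodType R[i])
    (act : schr R -> V -> V) (lc : R[i] * R[i]) : set V :=
  [set v | act (sh R) v = lc.1 *: v /\ act (sz R) v = lc.2 *: v].

Definition is_weight_module (R : realType) (V : lmodType R[i])
    (act : schr R -> V -> V) : Prop :=
  is_direct_sum (hz_space act).

Definition has_fin_dim_weight_spaces (R : realType) (V : lmodType R[i])
    (act : schr R -> V -> V) : Prop :=
  forall lc : R[i] * R[i], is_fin_dim (hz_space act lc).

Definition h_space (R : realType) (V : lmodType R[i])
    (act : schr R -> V -> V) (l : R[i]) : set V :=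
  [set v | act (sh R) v = l *: v].

Definition supp (R : realType) (V : lmodType R[i])
    (act : schr R -> V -> V) : set R[i] :=
  [set l | exists v : V, v != 0 /\ h_space act l v].

(* This is not the library order on R[i]. *)
Definition weight_le (R : realType) (l1 l2 : R[i]) : Prop :=
  exists n : nat, l2 - l1 = n%:R.

Definition is_highest_weight (R : realType) (V : lmodType R[i])
    (act : schr R -> V -> V) (l : R[i]) : Prop :=
  supp act l /\ forall m, supp act m -> weight_le l m -> m = l.

Definition is_lowest_weight (R : realType) (V : lmodType R[i])
    (act : schr R -> V -> V) (l : R[i]) : Prop :=
  supp act l /\ forall m, supp act m -> weight_le m l -> m = l.

Definition is_highest_weight_module (R : realType) (V : lmodType R[i])
    (act : schr R -> V -> V) : Prop :=
  exists (l : R[i]) (v : V),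
    [/\ is_highest_weight act l, h_space act l v & generated_by act v].

Definition is_lowest_weight_module (R : realType) (V : lmodType R[i])
    (act : schr R -> V -> V) : Prop :=
  exists (l : R[i]) (v : V),
    [/\ is_lowest_weight act l, h_space act l v & generated_by act v].

Definition is_dense_sl2_module (R : realType) (V : lmodType R[i])
    (act : schr R -> V -> V) : Prop :=
  [/\ forall v, act (sp R) v = 0 /\ act (sq R) v = 0,
      is_simple act,
      is_weight_module act
    & exists mu : R[i], supp act = [set mu + 2 * k%:~R | k in [set: int]]].

(* V is isomorphic to B^(q)_x(N(l, c)) with l = n - 1/2: it has a basis
   v i j, i an integer and 0 <= j <= n, on which the generators act by the
   defining formulas of that module. Here n = l + 1/2, so that l + 3/2 = n + 1
   and 2 l + 3 - 2 s = 2 (n + 1 - s). In the actions of p and e the truncated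
   j.-1 at j = 0 comes with coefficient 0. *)
Definition is_Bq (R : realType) (V : lmodType R[i])
    (act : schr R -> V -> V) (n : nat) (c x : R[i]) : Prop :=
  let l : R[i] := n%:R - 2^-1 in
  exists v : int -> nat -> V,
    is_basis (fun ij : int * 'I_n.+1 => v ij.1 ij.2) /\
    forall (i : int) (j : nat), (j <= n)%N ->
    let y : R[i] := i%:~R + x in
    [/\ act (sq R) (v i j) = v (i + 1) j,
        act (sf R) (v i j) =
          (if (j < n)%N then v i j.+1
           else - \sum_(s < n.+1)
                    (((2 * c) ^+ (n.+1 - s))^-1 * 'C(n.+1, s)%:R)
                      *: v (i + (2 * (n.+1 - s))%N%:Z) s)
      & act (sz R) (v i j) = c *: v i j] /\
    [/\ act (sh R) (v i j) = (l - y - 2 * j%:R) *: v i j,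
        act (sp R) (v i j) =
          - j%:R *: v (i + 1) j.-1 + (c * y) *: v (i - 1) j
      & act (se R) (v i j) =
          (j%:R * (l + 1 - y - j%:R)) *: v i j.-1
          + (2^-1 * c * y * (y - 1)) *: v (i - 2) j].

(* Main.v *)
From HB Require Import structures.
Require Import Defs.
From mathcomp Require Import all_boot all_order all_algebra.
From mathcomp Require Import complex.
From mathcomp Require Import classical_sets reals.
From mathcomp Require Import boolp.
From mathcomp Require Import ring lra zify.
Import Order.TTheory GRing.Theory Num.Theory.
Local Open Scope ring_scope.

Set Implicit Arguments.
Unset Strict Implicit.
Unset Printing Implicit Defensive.

(** By Schur's argument z acts by a scalar c. Each of e, f, p, q is
    ad-nilpotent, so the vectors killed by a power of it form a submodule: it
    acts on V either injectively or locally nilpotently ([dichotomy]).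

    If e is locally nilpotent, a power e^m kills the finite-dimensional weight
    space V_N. Were there weights N + 2 m' with m' >= m, a vector u with e u = 0
    far up could be lowered by f into V_N and recovered, up to a nonzero factor,
    by a power of e that is zero there ([raising_bound]). So the support is
    bounded above, and V, being simple, is a highest weight module. The
    involution e <-> f, p <-> q ([swr_swap]) turns a locally nilpotent f into a
    lowest weight. If c != 0, the same argument applies to the Weyl pair (p, q).
    Only modules on which e and f are injective remain.

    Case c = 0. If p were injective, it would be bijective between weight
    spaces, and p^-2 e and p q would be operators X, Y on a weight space with
    [X, Y] = 1, which the trace forbids ([no_fin_dim_weyl]). So p and likewise q
    are locally nilpotent; they commute, so they have a common kernel, which is
    a submodule. Hence p = q = 0, and injectivity of e and f makes the support a
    full coset of 2 Z.

    Case c != 0 with p and q injective, hence bijective. The operators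
    e' = e - p^2 / 2c, f' = f + q^2 / 2c, h' = h + q p / c + 1/2 form an
    sl2-triple commuting with p and q. From a joint eigenvector v of h and q p,
    the vectors q^2k e'^k v stay in one weight space and have distinct
    eigenvalues for q p, so e'^k v = 0 for some k ([loc_nil_by_spectrum]);
    similarly for f'. This gives a vector u generating a finite-dimensional
    sl2-module under e', f', of dimension n + 1 say. Powers of q move u to a
    vector with 0 <= Re x < 1, and the vectors f^j q^i u with j <= n, i in Z are
    the required basis; the formula for f (f^n q^i u) is the binomial expansion
    of f'^(n+1) q^i u = 0. *)

(** * Finite-dimensional subspaces and their endomorphisms *)

Section FiniteDimension.
Variables (K : numClosedFieldType) (V : lmodType K).
Implicit Types (W : V -> Prop) (T : {linear V -> V}).

Definition subspace W :=
  W 0 /\ forall (k : K) u v, W u -> W v -> W (k *: u + v).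

Definition comb m (b : 'I_m -> V) (u : 'rV[K]_m) : V := \sum_i u 0 i *: b i.

Lemma comb_is_linear m (b : 'I_m -> V) : linear (comb b).
Proof.
move=> k u v; rewrite /comb scaler_sumr -big_split; apply: eq_bigr => i _ /=.
by rewrite !mxE scalerDl scalerA.
Qed.

HB.instance Definition _ m (b : 'I_m -> V) :=
  GRing.isLinear.Build K 'rV[K]_m V *:%R (comb b) (comb_is_linear b).

Definition fin_coord W := exists (d : nat) (phi : {linear 'rV[K]_d -> V}),
  injective phi /\ forall v, W v <-> exists u, v = phi u.

(** A spanning family with a dependency stays spanning when a vector of the
    dependency is dropped; a shortest spanning family therefore gives linear
    coordinates. *)
Lemma fin_dim_coord W : subspace W -> is_fin_dim W -> fin_coord W.
Proof.
move=> [W0 Wlin] [m [b [Wb spanb]]].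
have {spanb} : forall v, W v -> exists u, v = comb b u.
  move=> v /spanb[k ->]; exists (\row_i k i).
  by apply: eq_bigr => i _; rewrite mxE.
elim: m b Wb => [|m IHm] b Wb spanb.
  exists 0%N, (comb b); split=> [u v _|v].
    by apply/rowP; case.
  by split=> [/spanb//|[u ->]]; rewrite /= /comb big_ord0.
have [inj_b|/existsNP[u /not_implyP[bu0 u0]]] :=
    pselect (forall u, comb b u = 0 -> u = 0).
  exists m.+1, (comb b); split=> [u v uv|v].
    by apply/eqP; rewrite -subr_eq0; apply/eqP/inj_b; rewrite linearB /= uv subrr.
  split=> [/spanb//|[u ->]]; rewrite /= /comb.
  apply: (big_ind W) => // [x y Wx Wy|i _].
    by rewrite -[x]scale1r; apply: Wlin.
  by rewrite -[_ *: _]addr0; apply: Wlin.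
have /rV0Pn[i ui0] : u != 0 by apply/eqP.
apply: (IHm (fun j => b (lift i j))) => // v /spanb[k ->].
(* Subtract a multiple of the dependency u to clear coordinate i. *)
pose k' := k - (k 0 i / u 0 i) *: u.
exists (\row_j k' 0 (lift i j)).
have -> : comb b k = comb b k' by rewrite linearB linearZ /= bu0 scaler0 subr0.
rewrite /comb (bigD1_ord i) //= {1}/k' !mxE divfK // subrr scale0r add0r.
by apply: eq_bigr => j _; rewrite mxE.
Qed.

(** Source and target have their own coordinates, so that a weight space can
    be compared with a shifted one through coordinates transported from the
    first. *)
Lemma matrix_of_map d (phi : {linear 'rV[K]_d -> V})
    (psi : {linear 'rV[K]_d -> V}) T :
  (forall u, exists w, T (phi u) = psi w) ->
  exists A : 'M[K]_d, forall u, T (phi u) = psi (u *m A).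
Proof.
move=> Tphi.
have [g gE] := choice (fun i : 'I_d => Tphi (delta_mx 0 i)).
exists (\matrix_i g i) => u.
rewrite mulmx_sum_row {1}[u]row_sum_delta !linear_sum; apply: eq_bigr => i _.
by rewrite !linearZ /= gE rowK.
Qed.

Lemma fin_coord_endo W T : fin_coord W -> (forall v, W v -> W (T v)) ->
  exists (d : nat) (phi : {linear 'rV[K]_d -> V}) (A : 'M[K]_d),
    [/\ injective phi, forall v, W v <-> exists u, v = phi u
      & forall u, T (phi u) = phi (u *m A)].
Proof.
move=> [d [phi [inj_phi WE]]] WT.
have [|A AE] := @matrix_of_map d phi phi T; last by exists d, phi, A; split.
by move=> u; apply/WE/WT/WE; exists u.
Qed.

Lemma linear_eq0_inj (U1 U2 : lmodType K) (F : {linear U1 -> U2}) :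
  injective F -> forall u, F u = 0 -> u = 0.
Proof. by move=> injF u Fu; apply: injF; rewrite Fu linear0. Qed.

(** Surjectivity between different weight spaces is obtained from this by
    composing maps into a loop, so that dimensions never have to be compared. *)
Lemma inj_endo_surj W T : fin_coord W -> (forall v, W v -> W (T v)) ->
  (forall v, T v = 0 -> v = 0) -> forall w, W w -> exists2 v, W v & w = T v.
Proof.
move=> fW WT injT w.
have [d [phi [A [inj_phi WE TA]]]] := fin_coord_endo fW WT.
have uA : A \in unitmx.
  rewrite -row_free_unit; apply/inj_row_free => u uA0.
  apply: (linear_eq0_inj inj_phi); apply: injT.
  by rewrite TA uA0 linear0.
move=> /WE[u ->]; exists (phi (u *m invmx A)).
  by apply/WE; eexists.
by rewrite TA mulmxKV.
Qed.

Lemma exists_eigenvector W T : fin_coord W -> (forall v, W v -> W (T v)) ->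
  (exists2 v, W v & v <> 0) ->
  exists a v, [/\ W v, v <> 0 & T v = a *: v].
Proof.
move=> fW WT [v0 Wv0 v0N].
have [d [phi [A [inj_phi WE TA]]]] := fin_coord_endo fW WT.
have d0 : (0 < d)%N.
  case: d phi A inj_phi WE TA => // phi A inj_phi WE _; case: v0N.
  by move/WE: Wv0 => [u ->]; rewrite [u]thinmx0 linear0.
have [a /eigenvalueP[u uA u0]] := eigenvalue_closed A d0.
exists a, (phi u); split; first by apply/WE; eexists.
  by move/(linear_eq0_inj inj_phi)/eqP; apply/negP.
by rewrite TA uA linearZ.
Qed.

(** Eigenvalues are roots of a characteristic polynomial. *)
Lemma no_infinite_spectrum W T (a : nat -> K) (v : nat -> V) : fin_coord W ->
  (forall v, W v -> W (T v)) -> injective a ->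
  (forall k, W (v k) /\ T (v k) = a k *: v k) -> exists k, v k = 0.
Proof.
move=> fW WT inj_a vE; apply: contrapT => /forallNP vN0.
have [d [phi [A [inj_phi WE TA]]]] := fin_coord_endo fW WT.
have := @max_poly_roots K (char_poly A) [seq a k | k <- iota 0 d.+1].
rewrite size_char_poly size_map size_iota ltnn => H.
suff: false by []; apply: H.
- by rewrite -size_poly_gt0 size_char_poly.
- apply/allP => _ /mapP[k _ ->]; rewrite -eigenvalue_root_char.
  have [/WE[u vu] Tv] := vE k.
  apply/eigenvalueP; exists u.
    by apply: inj_phi; rewrite -TA -vu Tv vu linearZ.
  by apply/eqP => u0; apply: (vN0 k); rewrite vu u0 linear0.
- by rewrite map_inj_uniq // iota_uniq.
Qed.

(** With X := S^-1 E this says that the Weyl relation [X, Y] = 1 has no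
    solution in a nonzero finite dimension: a commutator has trace zero. *)
Lemma no_fin_dim_weyl W (E Y S : {linear V -> V}) : fin_coord W ->
  (forall v, W v -> W (Y v)) ->
  (forall v, S v = 0 -> v = 0) ->
  (forall v, W v -> exists2 w, W w & E v = S w) ->
  (forall v, S (Y v) = Y (S v)) ->
  (forall v, E (Y v) = Y (E v) + S v) ->
  forall v, W v -> v = 0.
Proof.
move=> fW WY injS ES SY EY v.
have [d [phi [B [inj_phi WE YB]]]] := fin_coord_endo fW WY.
have [|A EA] := @matrix_of_map d phi (S \o phi)%FUN E.
  move=> u; have [|w /WE[x ->] ->] := ES (phi u); first by apply/WE; exists u.
  by exists x.
rewrite /= in EA.
have key (u : 'rV_d) : u *m B *m A = u *m A *m B + u.
  have injS' : injective S.
    move=> x y xy; apply/eqP; rewrite -subr_eq0.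
    by apply/eqP/injS; rewrite linearB /= xy subrr.
  apply/inj_phi/injS'; rewrite -EA -YB EY EA -SY YB.
  by rewrite -linearD -linearD.
have BA : B *m A - A *m B = 1%:M.
  apply/row_matrixP => i; rewrite rowE mulmxBr !mulmxA key row1.
  by rewrite addrAC subrr add0r.
have /eqP : \tr (1%:M : 'M[K]_d) = 0 by rewrite -BA linearB /= mxtrace_mulC subrr.
rewrite mxtrace1 pnatr_eq0 => /eqP d0.
move=> /WE[u ->]; move: phi u {A B inj_phi WE YB EA key BA}; rewrite d0.
by move=> phi u; rewrite [u]thinmx0 linear0.
Qed.

End FiniteDimension.

(** * Iterated operators *)

Section Iteration.
Variables (K : numClosedFieldType) (V : lmodType K).
Implicit Types (h E F H X Y Z T : {linear V -> V}) (u v w : V).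

Definition loc_nil (X : V -> V) v := exists m, iter m X v = 0.

Lemma iter_is_linear m X : linear (iter m X).
Proof.
by move=> k u v; elim: m => //= m ->; rewrite linearP.
Qed.

HB.instance Definition _ m X :=
  GRing.isLinear.Build K V V *:%R (iter m X) (iter_is_linear m X).

Lemma iter_eq0_ge X v m m' : iter m X v = 0 -> (m <= m')%N -> iter m' X v = 0.
Proof. by move=> v0 /subnK <-; rewrite iterD v0 linear0. Qed.

Lemma iter_inj_eq0 X m v : (forall v, X v = 0 -> v = 0) ->
  iter m X v = 0 -> v = 0.
Proof. by move=> injX; elim: m => //= m IHm /injX. Qed.

Lemma iter_comm X Y m v : (forall v, X (Y v) = Y (X v)) ->
  X (iter m Y v) = iter m Y (X v).
Proof. by move=> XY; elim: m => //= m <-. Qed.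

Lemma loc_nil_subspace X : subspace (loc_nil X).
Proof.
split=> [|k u v [m um] [n vn]]; first by exists 0%N.
exists (m + n)%N; rewrite linearP /= (iter_eq0_ge um) ?leq_addr //.
by rewrite (iter_eq0_ge vn) ?leq_addl // scaler0 addr0.
Qed.

Lemma loc_nilD X u v : loc_nil X u -> loc_nil X v -> loc_nil X (u + v).
Proof. by rewrite -{2}[u]scale1r; case: (loc_nil_subspace X) => _; apply. Qed.

(** When ad X acts nilpotently on an operator Y, the vectors killed by a power
    of X are stable under Y: this is the induction step, from [X, Y] to Y. *)
Lemma loc_nil_stable X (Y Z : V -> V) :
  (forall v, X (Y v) = Y (X v) + Z v) -> Y 0 = 0 ->
  (forall v, loc_nil X v -> loc_nil X (Z v)) ->
  forall v, loc_nil X v -> loc_nil X (Y v).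
Proof.
move=> XY Y0 ZX v [m]; elim: m v => [v /= ->|m IHm v Xv].
  by exists 0%N.
have [n Yn] : loc_nil X (X (Y v)); last by exists n.+1; rewrite iterSr.
rewrite XY; apply: loc_nilD; first by apply: IHm; rewrite -iterSr.
by apply: ZX; exists m.+1.
Qed.

Lemma loc_nil_last X v : loc_nil X v -> v <> 0 ->
  exists k, iter k X v <> 0 /\ X (iter k X v) = 0.
Proof.
move=> [m]; elim: m => [//|m IHm Xv v0].
have [/IHm/(_ v0)//|Xm0] := pselect (iter m X v = 0).
by exists m.
Qed.

Lemma loc_nil_uniform X (W : V -> Prop) : fin_coord W ->
  (forall v, loc_nil X v) -> exists m, forall v, W v -> iter m X v = 0.
Proof.
move=> [d [phi [_ WE]]] Xnil.
have [m mE] := choice (fun i : 'I_d => Xnil (phi (delta_mx 0 i))).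
exists (\sum_i m i)%N => _ /WE[u ->].
rewrite [u]row_sum_delta !linear_sum big1 // => i _.
rewrite !linearZ /= (iter_eq0_ge (mE i)) ?scaler0 //.
by rewrite (bigD1 i) //= leq_addr.
Qed.

Lemma iter_ladder X Y (a : nat -> K) u j :
  (forall k, X (iter k.+1 Y u) = a k *: iter k Y u) ->
  iter j X (iter j Y u) = (\prod_(i < j) a i) *: u.
Proof.
move=> XY; elim: j => [|j IHj]; first by rewrite big_ord0 scale1r.
by rewrite iterSr XY linearZ /= IHj scalerA big_ord_recr /= mulrC.
Qed.

Lemma iter_ladder_gt X Y (a : nat -> K) u j J :
  (forall k, X (iter k.+1 Y u) = a k *: iter k Y u) -> X u = 0 -> (j < J)%N ->
  iter J X (iter j Y u) = 0.
Proof.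
move=> XY Xu /subnK <-; rewrite iterD /= (iter_ladder _ XY).
by rewrite linearZ /= Xu scaler0 linear0.
Qed.

Lemma iter_derivation X Y (Z : V -> V) j v :
  (forall v, X (Y v) = Y (X v) + Z v) -> (forall v, Z (Y v) = Y (Z v)) ->
  X (iter j Y v) = iter j Y (X v) + j%:R *: Z (iter j.-1 Y v).
Proof.
move=> XY ZY; elim: j => [|j IHj]; first by rewrite scale0r addr0.
rewrite iterS XY IHj linearD linearZ /= -addrA; congr (_ + _).
case: j {IHj} => [|j]; first by rewrite scale0r add0r scale1r.
by rewrite -ZY /= -[in RHS]addn1 natrD scalerDl scale1r.
Qed.

(** [e, f^j] = j f^(j-1) (h - j + 1), on a vector of weight m. *)
Lemma sl2_lowering E F H (m : K) j v :
  (forall v, E (F v) = F (E v) + H v) ->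
  (forall v, H (F v) = F (H v) - 2 *: F v) ->
  H v = m *: v ->
  E (iter j F v) = iter j F (E v) + (j%:R * (m + 1 - j%:R)) *: iter j.-1 F v.
Proof.
move=> EF HF Hv.
have HFj k : H (iter k F v) = (m - 2 * k%:R) *: iter k F v.
  elim: k => [|k IHk]; first by rewrite mulr0 subr0.
  rewrite iterS HF IHk linearZ -scalerBl; congr (_ *: _).
  by rewrite -addn1 natrD; ring.
elim: j => [|j IHj]; first by rewrite mul0r scale0r addr0.
rewrite iterS EF IHj HFj linearD linearZ /= -addrA; congr (_ + _).
case: j {IHj} => [|j]; first by rewrite mul0r scale0r add0r; congr (_ *: _); ring.
by rewrite -iterS -scalerDl; congr (_ *: _); rewrite -addn2 -[j.+1]addn1 !natrD; ring.
Qed.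

Lemma sl2_lowering_top E F H (m : K) j v :
  (forall v, E (F v) = F (E v) + H v) ->
  (forall v, H (F v) = F (H v) - 2 *: F v) ->
  H v = m *: v -> E v = 0 ->
  E (iter j.+1 F v) = (j.+1%:R * (m - j%:R)) *: iter j F v.
Proof.
move=> EF HF Hv Ev; rewrite (sl2_lowering _ EF HF Hv) Ev linear0 add0r.
by congr (_ *: _); rewrite -addn1 natrD; ring.
Qed.

Lemma iter_addf X Y n v : (forall v, X (Y v) = Y (X v)) ->
  iter n (X \+ Y) v =
  \sum_(s < n.+1) 'C(n, s)%:R *: iter s X (iter (n - s) Y v).
Proof.
move=> XY; elim: n => [|n IHn]; first by rewrite big_ord1 scale1r.
pose G s := iter s X (iter (n.+1 - s) Y v).
have XG : X (iter n (X \+ Y) v) = \sum_(s < n.+1) 'C(n, s)%:R *: G s.+1.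
  by rewrite IHn linear_sum; apply: eq_bigr => s _; rewrite linearZ.
have YG : Y (iter n (X \+ Y) v) = \sum_(s < n.+2) 'C(n, s)%:R *: G s.
  rewrite IHn linear_sum [RHS]big_ord_recr /= bin_small // scale0r addr0.
  apply: eq_bigr => s _; rewrite linearZ /= (@iter_comm Y X) // -iterS.
  by rewrite /G subSn // -ltnS.
rewrite iterS /= XG YG [X in _ + X = _]big_ord_recl addrCA -big_split [RHS]big_ord_recl.
rewrite !bin0; congr (_ + _); apply: eq_bigr => s _ /=.
by rewrite -scalerDl -natrD binS addnC.
Qed.

(** Applying T - a_x removes the vector w_x and multiplies the other w_i by
    nonzero scalars. *)
Lemma eigen_indep (I : eqType) T (a : I -> K) (w : I -> V) (s : seq I) :
  uniq s -> {in s &, injective a} ->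
  (forall i, i \in s -> T (w i) = a i *: w i) ->
  \sum_(i <- s) w i = 0 -> forall i, i \in s -> w i = 0.
Proof.
elim: s w => [//|x s IHs] w /= /andP[xs us] inj_a Tw; rewrite big_cons => sum0.
have ws i : i \in s -> w i = 0.
  move=> si; have ix : a i - a x != 0.
    rewrite subr_eq0; apply: contraNneq xs => /inj_a <- //.
      by rewrite inE si orbT.
    by rewrite inE eqxx.
  suff /eqP : (a i - a x) *: w i = 0 by rewrite scaler_eq0 (negPf ix) => /eqP.
  apply: (IHs (fun i => (a i - a x) *: w i)) si => //.
  - by move=> i1 i2 s1 s2; apply: inj_a; rewrite inE ?s1 ?s2 orbT.
  - by move=> j sj; rewrite linearZ /= Tw ?inE ?sj ?orbT // !scalerA mulrC.
  have : T (w x + \sum_(i <- s) w i) - a x *: (w x + \sum_(i <- s) w i) = 0.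
    by rewrite sum0 linear0 scaler0 subr0.
  rewrite linearD scalerDr Tw ?inE ?eqxx // opprD addrACA subrr add0r.
  rewrite linear_sum scaler_sumr -sumrB => E0; rewrite -[RHS]E0.
  apply: eq_big_seq => j sj.
  by rewrite scalerBl Tw // inE sj orbT.
move=> i; rewrite inE => /predU1P[->|/ws//].
by move: sum0; rewrite big_seq big1 ?addr0 // => j /ws.
Qed.

(** If X is locally nilpotent, a power X^m kills the finite-dimensional
    eigenspace of weight N. A nonzero vector of weight N + m' s with m' >= m
    could be raised to a vector u killed by X, then lowered down to weight N
    by a power of Y; the same power of X would have to give u back. *)
Lemma raising_bound h X Y (s N : K) :
  (forall l v, h v = l *: v -> h (X v) = (l + s) *: X v) ->
  (forall l v, h v = l *: v -> h (Y v) = (l - s) *: Y v) ->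
  (forall v, loc_nil X v) -> fin_coord (fun v => h v = N *: v) ->
  (forall j u, h u = (N + j%:R * s) *: u -> X u = 0 ->
     iter j X (iter j Y u) = 0 -> u = 0) ->
  exists m, forall m', (m <= m')%N ->
    forall v, h v = (N + m'%:R * s) *: v -> v = 0.
Proof.
move=> hX hY Xnil fN XY.
have [m XmN] := loc_nil_uniform fN Xnil.
exists m => m' mm' v hv; apply: contrapT => v0.
have [k [uN Xu]] := loc_nil_last (Xnil v) v0.
have hXi i l w : h w = l *: w -> h (iter i X w) = (l + i%:R * s) *: iter i X w.
  elim: i => [|i IHi] hw; first by rewrite mul0r addr0.
  by rewrite iterS (hX _ _ (IHi hw)); congr (_ *: _); rewrite -addn1 natrD; ring.
have hYi i l w : h w = l *: w -> h (iter i Y w) = (l - i%:R * s) *: iter i Y w.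
  elim: i => [|i IHi] hw; first by rewrite mul0r subr0.
  by rewrite iterS (hY _ _ (IHi hw)); congr (_ *: _); rewrite -addn1 natrD; ring.
have hu : h (iter k X v) = (N + (m' + k)%:R * s) *: iter k X v.
  by rewrite (hXi _ _ _ hv); congr (_ *: _); rewrite natrD; ring.
apply/uN/(XY (m' + k)%N) => //.
apply: (@iter_eq0_ge _ _ m); last exact: leq_trans mm' (leq_addr _ _).
apply: XmN; rewrite (hYi _ _ _ hu); congr (_ *: _); ring.
Qed.

End Iteration.

(** * Simple weight representations on which z is a scalar *)

Section Representation.
Variables (K : numClosedFieldType) (V : lmodType K).
Implicit Types (e f h p q : {linear V -> V}) (c l : K) (u v w : V).

(** The generators as separate operators, rather than one action of the Lie
    algebra, so that they can be exchanged by an automorphism ([swr_swap]). *)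
Record schr_rep e f h p q c : Prop := SchrRep {
  rep_he : forall v, h (e v) = e (h v) + 2 *: e v;
  rep_hp : forall v, h (p v) = p (h v) + p v;
  rep_hf : forall v, h (f v) = f (h v) - 2 *: f v;
  rep_hq : forall v, h (q v) = q (h v) - q v;
  rep_eq : forall v, e (q v) = q (e v) + p v;
  rep_ep : forall v, e (p v) = p (e v);
  rep_ef : forall v, e (f v) = f (e v) + h v;
  rep_pf : forall v, p (f v) = f (p v) - q v;
  rep_fq : forall v, f (q v) = q (f v);
  rep_pq : forall v, p (q v) = q (p v) + c *: v }.

Definition simple_rep e f h p q :=
  (exists v : V, v <> 0) /\
  forall W : V -> Prop, subspace W ->
    (forall v, W v -> [/\ W (e v), W (f v), W (h v), W (p v) & W (q v)]) ->
    (forall v, W v -> v = 0) \/ (forall v, W v).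

Record simple_weight_rep e f h p q c : Prop := SimpleWeightRep {
  swr_rep : schr_rep e f h p q c;
  swr_simple : simple_rep e f h p q;
  swr_span : forall W : V -> Prop, subspace W ->
    (forall l v, h v = l *: v -> W v) -> forall v, W v;
  swr_fin : forall l, fin_coord (fun v => h v = l *: v) }.

(** The Chevalley involution exchanges e with f and p with q, hence highest
    with lowest weights. *)
Lemma swr_swap e f h p q c :
  simple_weight_rep e f h p q c ->
  simple_weight_rep f e (\- h : {linear V -> V}) q p (- c).
Proof.
have hN l v : (\- h)%R v = l *: v <-> h v = - l *: v.
  by rewrite /= scaleNr; split=> [ <-|->]; rewrite opprK.
move=> [[he hp hf hq eq ep ef pf fq pq] [V0 sV] spanV finV]; split.
- split=> v /=; rewrite ?linearN.
  + by rewrite hf opprB addrC.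
  + by rewrite hq opprB addrC.
  + by rewrite he opprD.
  + by rewrite hp opprD.
  + by rewrite pf subrK.
  + by rewrite fq.
  + by rewrite ef addrK.
  + by rewrite eq addrK.
  + by rewrite ep.
  + by rewrite pq scaleNr addrK.
- split=> // W sW WV; apply: sV => // v /WV[? ? Whv ? ?]; split=> //.
  have [W0 Wlin] := sW; have := Wlin (- 1) _ _ Whv W0.
  by rewrite addr0 scaleN1r /= opprK.
- move=> W sW wtW; apply: spanV => // l v hv.
  by apply: (wtW (- l)); apply/hN; rewrite opprK.
- move=> l; have [d [phi [inj_phi WE]]] := finV (- l).
  by exists d, phi; split=> // v; rewrite -WE; apply: hN.
Qed.

Section Structure.
Variables (e f h p q : {linear V -> V}) (c : K).
Hypothesis rep : simple_weight_rep e f h p q c.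
Let rel := swr_rep rep.

Lemma wt_e l v : h v = l *: v -> h (e v) = (l + 2) *: e v.
Proof. by move=> hv; rewrite (rep_he rel) hv linearZ -scalerDl. Qed.
Lemma wt_f l v : h v = l *: v -> h (f v) = (l - 2) *: f v.
Proof. by move=> hv; rewrite (rep_hf rel) hv linearZ -scalerBl. Qed.
Lemma wt_p l v : h v = l *: v -> h (p v) = (l + 1) *: p v.
Proof. by move=> hv; rewrite (rep_hp rel) hv linearZ /= scalerDl scale1r. Qed.
Lemma wt_q l v : h v = l *: v -> h (q v) = (l - 1) *: q v.
Proof. by move=> hv; rewrite (rep_hq rel) hv linearZ /= scalerBl scale1r. Qed.

Lemma dichotomy (X : {linear V -> V}) :
  (forall v, loc_nil X v -> [/\ loc_nil X (e v), loc_nil X (f v),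
     loc_nil X (h v), loc_nil X (p v) & loc_nil X (q v)]) ->
  (forall v, X v = 0 -> v = 0) \/ (forall v, loc_nil X v).
Proof.
move=> WX; case: (swr_simple rep) => _ /(_ _ (loc_nil_subspace X) WX).
by case=> [inj|]; [left=> v Xv; apply: inj; exists 1%N | right].
Qed.

Lemma loc_nil0 (X : {linear V -> V}) v : v = 0 -> loc_nil X v.
Proof. by move->; exists 0%N. Qed.

Lemma loc_nilZ (X : {linear V -> V}) k v : loc_nil X v -> loc_nil X (k *: v).
Proof. by move=> [m Xv]; exists m; rewrite linearZ /= Xv scaler0. Qed.

Lemma loc_nil_self (X : {linear V -> V}) v : loc_nil X v -> loc_nil X (X v).
Proof. by move=> [m Xv]; exists m; rewrite -iterSr /= Xv linear0. Qed.

(** Up to scalars, ad e sends f to h, h to e, q to p, and kills p. *)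
Lemma dichotomy_e : (forall v, e v = 0 -> v = 0) \/ (forall v, loc_nil e v).
Proof.
have Np v : loc_nil e v -> loc_nil e (p v).
  apply: (@loc_nil_stable _ _ e p (fun=> 0)); rewrite ?linear0 // => u.
    by rewrite (rep_ep rel) addr0.
  by move=> _; apply: loc_nil0.
have Nh v : loc_nil e v -> loc_nil e (h v).
  apply: (@loc_nil_stable _ _ e h (fun v => - 2 *: e v)); rewrite ?linear0 // => u.
    by rewrite (rep_he rel) scaleNr addrK.
  by move=> eu; apply/loc_nilZ/loc_nil_self.
apply: dichotomy => v ev; split.
- exact: loc_nil_self.
- by apply: (loc_nil_stable (rep_ef rel)); rewrite ?linear0.
- exact: Nh.
- exact: Np.
- by apply: (loc_nil_stable (rep_eq rel)); rewrite ?linear0.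
Qed.

(** Up to scalars, ad p sends f to q, q to 1, h to p, and kills e. *)
Lemma dichotomy_p : (forall v, p v = 0 -> v = 0) \/ (forall v, loc_nil p v).
Proof.
have Nq v : loc_nil p v -> loc_nil p (q v).
  by apply: (loc_nil_stable (rep_pq rel)); rewrite ?linear0 // => u /loc_nilZ.
have Nh v : loc_nil p v -> loc_nil p (h v).
  apply: (@loc_nil_stable _ _ p h (fun v => (- 1) *: p v)); rewrite ?linear0 // => u.
    by rewrite (rep_hp rel) scaleN1r addrK.
  by move=> eu; apply/loc_nilZ/loc_nil_self.
apply: dichotomy => v pv; split.
- apply: (@loc_nil_stable _ _ p e (fun=> 0)); rewrite ?linear0 // => u.
    by rewrite (rep_ep rel) addr0.
  by move=> _; apply: loc_nil0.
- apply: (@loc_nil_stable _ _ p f (fun v => (- 1) *: q v)); rewrite ?linear0 // => u.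
    by rewrite (rep_pf rel) scaleN1r.
  by move=> /Nq/loc_nilZ.
- exact: Nh.
- exact: loc_nil_self.
- exact: Nq.
Qed.

(** The supports of both parities are cut off by [raising_bound], which needs
    a starting weight N from which lowering never meets the obstruction
    N + i = 0 with i > 0; one of l and 0 will do. *)
Lemma bounded_of_loc_nil_e l : (forall v, loc_nil e v) ->
  exists m, forall j, (m <= j)%N -> forall v, h v = (l + j%:R) *: v -> v = 0.
Proof.
move=> enil.
have bound N : (forall i : nat, N + i.+1%:R <> 0) ->
    exists m, forall m', (m <= m')%N ->
    forall v, h v = (N + m'%:R * 2) *: v -> v = 0.
  move=> N0; apply: (@raising_bound _ _ h e f) => //.
  - exact: wt_e.
  - exact: wt_f.
  - exact: swr_fin rep N.
  move=> j u hu eu.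
  rewrite (iter_ladder (a := fun k => k.+1%:R * (N + j%:R * 2 - k%:R))); last first.
    by move=> k; rewrite (sl2_lowering_top _ (rep_ef rel) (rep_hf rel) hu eu).
  move/eqP; rewrite scaler_eq0 => /orP[|/eqP//]; rewrite prodf_seq_eq0.
  case/hasP => k _ /=; rewrite mulf_eq0 pnatr_eq0 /= => /eqP.
  have -> : N + j%:R * 2 - k%:R = N + (j + (j - k.+1)).+1%:R.
    case: k => k /= /subnK; move: (j - k.+1)%N => d <-.
    by rewrite -!natr1 !natrD -natr1; ring.
  by move/N0.
have [N [k0 [Nl N0]]] : exists N k0, N = l + k0%:R /\ forall i : nat, N + i.+1%:R <> 0.
  have [[i li]|nl] := pselect (exists i : nat, l + i.+1%:R = 0).
    by exists 0, i.+1; split=> // j /eqP; rewrite add0r pnatr_eq0.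
  by exists l, 0%N; rewrite addr0; split=> // j lj; apply: nl; exists j.
have [m1 m1P] := bound _ N0.
have [|m2 m2P] := bound (N + 1).
  by move=> i; rewrite -addrA -(natrD _ 1) => /N0.
exists (k0 + 2 * (m1 + m2) + 1)%N => j mj v hv.
have jE : j = (k0 + odd (j - k0) + (j - k0)./2 * 2)%N.
  by rewrite -addnA muln2 odd_double_half subnKC //; lia.
case: odd jE => jE; [apply: (m2P (j - k0)./2) | apply: (m1P (j - k0)./2)];
  try lia; rewrite hv Nl {1}jE !natrD natrM; congr (_ *: _);
  rewrite ?mulr1n ?mulr0n; ring.
Qed.

(** If c <> 0, then p and q / c form a Weyl algebra, whose lowering
    coefficients never vanish. *)
Lemma bounded_of_loc_nil_p l : c != 0 -> (forall v, loc_nil p v) ->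
  exists m, forall j, (m <= j)%N -> forall v, h v = (l + j%:R) *: v -> v = 0.
Proof.
move=> c0 pnil.
have [|m mP] := @raising_bound _ _ h p q 1 l wt_p wt_q pnil (swr_fin rep l).
  move=> j u _ pu; rewrite (iter_ladder (a := fun k => k.+1%:R * c)); last first.
    move=> k; rewrite (iter_derivation (Z := fun v => c *: v)) ?pu.
    + by rewrite linear0 add0r scalerA.
    + exact: rep_pq rel.
    + by move=> v; rewrite linearZ.
  move/eqP; rewrite scaler_eq0 => /orP[|/eqP//]; rewrite prodf_seq_eq0.
  by case/hasP => k _ /=; rewrite mulf_eq0 pnatr_eq0 (negPf c0).
by exists m => j mj v hv; apply: (mP j mj); rewrite mulr1.
Qed.

Lemma wt_span_surj (X : {linear V -> V}) :
  (forall l v, h v = l *: v -> exists w, v = X w) -> forall v, exists w, v = X w.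
Proof.
apply: (swr_span rep (W := fun v => exists w, v = X w)); split.
  by exists 0; rewrite linear0.
by move=> k _ _ [u ->] [v ->]; exists (k *: u + v); rewrite linearP.
Qed.

(** For c = 0 the operator Y = p q shifts under e by p^2, which commutes with
    it. If p were invertible, p^-2 e and Y would satisfy the Weyl relation on
    every weight space. *)
Lemma loc_nil_p : c = 0 -> (forall v, e v = 0 -> v = 0) ->
  (forall v, f v = 0 -> v = 0) -> forall v, loc_nil p v.
Proof.
move=> c0 inj_e inj_f; case: dichotomy_p => // inj_p.
have pq v : p (q v) = q (p v) by rewrite (rep_pq rel) c0 scale0r addr0.
case: (swr_simple rep) => [[v0 v0N] _]; case: v0N.
suff : forall v, v = 0 by apply.
apply: (swr_span rep); first by split=> // k u v -> ->; rewrite scaler0 addr0.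
move=> l v; move: v; apply: (@no_fin_dim_weyl _ _ (fun v => h v = l *: v) e
    (p \o q : {linear V -> V}) (p \o p : {linear V -> V})) => //=.
- exact: swr_fin rep l.
- by move=> v /wt_q/wt_p; rewrite subrK.
- by move=> v /inj_p/inj_p.
- move=> v hv.
  (* e v lies in the image of p^2 because p^2 f is an injective endomorphism of
     the weight space of e v. *)
  have [|||w hw vE] := @inj_endo_surj _ _ (fun v => h v = (l + 2) *: v)
      ((p \o p) \o f : {linear V -> V}) (swr_fin rep _) _ _ (e v).
  + move=> u /wt_f/wt_p/wt_p /= ->; congr (_ *: _); ring.
  + by move=> u /= /inj_p/inj_p/inj_f.
  + exact: wt_e.
  exists (f w) => //; move/wt_f: hw => ->; congr (_ *: _); ring.
- by move=> v; rewrite !pq.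
- move=> v; rewrite (rep_ep rel) (rep_eq rel) linearD; congr (_ + _).
Qed.

End Structure.
End Representation.

(** * Nonzero central charge: the decoupled sl2-triple *)

Section Span.
Variables (K : numClosedFieldType) (V : lmodType K) (I : eqType) (b : I -> V).

Definition lin_span v :=
  exists (s : seq I) (k : I -> K), uniq s /\ v = \sum_(i <- s) k i *: b i.

Lemma sum_extend (s s' : seq I) (k : I -> K) : uniq s -> uniq s' ->
  {subset s <= s'} ->
  \sum_(i <- s) k i *: b i = \sum_(i <- s') (if i \in s then k i else 0) *: b i.
Proof.
move=> us us' ss'; rewrite [RHS](eq_bigr (fun i => if i \in s then k i *: b i else 0)).
  rewrite -[RHS]big_mkcond -[RHS]big_filter; apply: perm_big.
  apply: uniq_perm => //; first exact: filter_uniq.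
  by move=> i; rewrite mem_filter; case: (boolP (i \in s)) => // /ss' ->.
by move=> i _; case: ifP; rewrite ?scale0r.
Qed.

Lemma lin_span_subspace : subspace lin_span.
Proof.
split=> [|k _ _ [s1 [k1 [u1 ->]]] [s2 [k2 [u2 ->]]]].
  by exists [::], (fun=> 0); rewrite big_nil.
pose s := undup (s1 ++ s2).
have us : uniq s by apply: undup_uniq.
have s1s : {subset s1 <= s} by move=> i si; rewrite mem_undup mem_cat si.
have s2s : {subset s2 <= s} by move=> i si; rewrite mem_undup mem_cat si orbT.
eexists s, (fun i => k * _ + _); split=> //.
rewrite (sum_extend k1 u1 us s1s) (sum_extend k2 u2 us s2s) scaler_sumr.
by rewrite -big_split; apply: eq_bigr => i _; rewrite /= scalerA -scalerDl.
Qed.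

Lemma lin_span_gen i : lin_span (b i).
Proof. by exists [:: i], (fun=> 1); rewrite big_seq1 scale1r. Qed.

Lemma lin_spanZ k v : lin_span v -> lin_span (k *: v).
Proof.
have [W0 Wlin] := lin_span_subspace => /(Wlin k)/(_ W0).
by rewrite addr0.
Qed.

Lemma lin_spanD u v : lin_span u -> lin_span v -> lin_span (u + v).
Proof. by rewrite -{2}[u]scale1r; case: lin_span_subspace => _; apply. Qed.

Lemma lin_span_sum J (r : seq J) (F : J -> V) :
  (forall j, lin_span (F j)) -> lin_span (\sum_(j <- r) F j).
Proof.
move=> WF; apply: (big_ind lin_span) => //; last exact: lin_spanD.
by case: lin_span_subspace.
Qed.

Lemma lin_span_stable (T : {linear V -> V}) : (forall i, lin_span (T (b i))) ->
  forall v, lin_span v -> lin_span (T v).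
Proof.
move=> WT _ [s [k [_ ->]]]; rewrite linear_sum; apply: lin_span_sum => i.
by rewrite linearZ; apply: lin_spanZ.
Qed.

End Span.

Section Charged.
Variables (K : numClosedFieldType) (V : lmodType K).
Variables (e f h p q : {linear V -> V}) (c : K).
Hypothesis rep : simple_weight_rep e f h p q c.
Hypothesis c0 : c != 0.
Hypothesis inj_p : forall v, p v = 0 -> v = 0.
Hypothesis inj_q : forall v, q v = 0 -> v = 0.
Let rel := swr_rep rep.
Let pq := rep_pq rel.
Implicit Types (u v : V) (l y : K).

(** p and q / c generate a Weyl algebra, whose quadratic elements realise sl2 on
    its own; subtracting that realisation from e, f, h leaves an sl2-triple that
    commutes with p and q. *)
Definition dec_e : {linear V -> V} := e \- (2 * c)^-1 \*: (p \o p).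
Definition dec_f : {linear V -> V} := f \+ (2 * c)^-1 \*: (q \o q).
Definition dec_h : {linear V -> V} :=
  (h \+ c^-1 \*: (q \o p)) \+ 2^-1 \*: idfun.

Lemma dec_eE v : dec_e v = e v - (2 * c)^-1 *: p (p v). Proof. by []. Qed.
Lemma dec_fE v : dec_f v = f v + (2 * c)^-1 *: q (q v). Proof. by []. Qed.
Lemma dec_hE v : dec_h v = h v + c^-1 *: q (p v) + 2^-1 *: v. Proof. by []. Qed.

Let c2K : (2 * c)^-1 * c = 2^-1.
Proof. by rewrite invfM mulrVK ?unitfE. Qed.

Lemma ppq v : p (p (q v)) = q (p (p v)) + (2 * c) *: p v.
Proof. by rewrite pq linearD linearZ /= pq -addrA -scalerDl -mulr2n mulr_natl. Qed.

Lemma pqq v : p (q (q v)) = q (q (p v)) + (2 * c) *: q v.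
Proof. by rewrite !pq linearD linearZ /= -addrA -scalerDl -mulr2n mulr_natl. Qed.

Let c2N0 : 2 * c != 0. Proof. by rewrite mulf_neq0 ?pnatr_eq0. Qed.

Lemma dec_e_p v : dec_e (p v) = p (dec_e v).
Proof. by rewrite !dec_eE (linearB p) (linearZ_LR p) /= (rep_ep rel). Qed.

Lemma dec_e_q v : dec_e (q v) = q (dec_e v).
Proof.
rewrite !dec_eE ppq (rep_eq rel) (linearB q) (linearZ_LR q) /= scalerDr scalerA mulVf //.
by rewrite scale1r opprD addrACA subrr addr0.
Qed.

Lemma dec_f_q v : dec_f (q v) = q (dec_f v).
Proof. by rewrite !dec_fE (linearD q) (linearZ_LR q) /= (rep_fq rel). Qed.

Lemma dec_f_p v : dec_f (p v) = p (dec_f v).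
Proof.
rewrite !dec_fE (linearD p) (linearZ_LR p) /= (rep_pf rel) pqq scalerDr scalerA mulVf //.
by rewrite scale1r [RHS]addrACA addNr addr0.
Qed.

Lemma dec_ef v : dec_e (dec_f v) = dec_f (dec_e v) + dec_h v.
Proof.
have qqE : dec_e (q (q v)) = q (q (dec_e v)) by rewrite !dec_e_q.
have ppf : p (p (f v)) = f (p (p v)) - 2 *: q (p v) - c *: v.
  rewrite !(rep_pf rel) (linearB p) /= (rep_pf rel) pq opprD !addrA; congr (_ - _).
  by rewrite -addrA -opprD -mulr2n scaler_nat.
have fE : dec_e (f v) = f (dec_e v) + dec_h v.
  rewrite !dec_eE dec_hE ppf (rep_ef rel) (linearB f) (linearZ_LR f) /=.
  rewrite !scalerBr !scalerA c2K.
  have -> : (2 * c)^-1 * 2 = c^-1 by rewrite invfM mulrC mulrA divff ?mul1r ?pnatr_eq0.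
  rewrite !opprB -!addrA; congr (_ + _); rewrite [RHS]addrCA; congr (_ + _).
  by rewrite [RHS]addrC addrAC addrC.
rewrite dec_fE (linearD dec_e) (linearZ_LR dec_e) fE qqE [in RHS]dec_fE.
by rewrite addrAC.
Qed.

Lemma dec_hf v : dec_h (dec_f v) = dec_f (dec_h v) - 2 *: dec_f v.
Proof.
have hq u : dec_h (q u) = q (dec_h u).
  rewrite !dec_hE (rep_hq rel) pq !(linearD q) !(linearZ_LR q) /= scalerDr scalerA.
  by rewrite mulVf // scale1r addrACA addNr addr0.
have hf : dec_h (f v) = f (dec_h v) - 2 *: dec_f v.
  rewrite !dec_hE dec_fE (rep_hf rel) (rep_pf rel) (linearB q).
  rewrite !(linearD f) !(linearZ_LR f) /= -(rep_fq rel).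
  rewrite scalerBr scalerDr scalerA opprD.
  have -> : 2 * (2 * c)^-1 = c^-1 by rewrite invfM mulrA divff ?mul1r ?pnatr_eq0.
  by rewrite -!addrA; congr (_ + _); rewrite addrCA; congr (_ + _);
     rewrite addrA addrC.
rewrite [in LHS]dec_fE (linearD dec_h) (linearZ_LR dec_h) hf !hq [in RHS]dec_fE.
by rewrite addrAC.
Qed.

(** Used with T = q p. Q moves the joint eigenvalues of T and h by (t, -r), and
    X moves them by (0, 2 r). Hence Q^2k X^k v stays in one weight space, with
    T-eigenvalues that are pairwise distinct, so it vanishes for some k. *)
Lemma loc_nil_by_spectrum (X Q T : {linear V -> V}) (r t a l : K) v :
  t != 0 ->
  (forall m u, h u = m *: u -> h (X u) = (m + 2 * r) *: X u) ->
  (forall m u, h u = m *: u -> h (Q u) = (m - r) *: Q u) ->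
  (forall m u, h u = m *: u -> h (T u) = m *: T u) ->
  (forall u, T (X u) = X (T u)) -> (forall u, T (Q u) = Q (T u) + t *: Q u) ->
  (forall u, Q u = 0 -> u = 0) ->
  h v = l *: v -> T v = a *: v -> loc_nil X v.
Proof.
move=> t0 hX hQ hT TX TQ injQ hv Tv.
have hXi i u m : h u = m *: u -> h (iter i X u) = (m + 2 * (i%:R * r)) *: iter i X u.
  elim: i => [|i IHi] hu; first by rewrite mul0r mulr0 addr0.
  by rewrite iterS (hX _ _ (IHi hu)); congr (_ *: _); rewrite -natr1; ring.
have hQi i u m : h u = m *: u -> h (iter i Q u) = (m - i%:R * r) *: iter i Q u.
  elim: i => [|i IHi] hu; first by rewrite mul0r subr0.
  by rewrite iterS (hQ _ _ (IHi hu)); congr (_ *: _); rewrite -natr1; ring.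
have TQi i u b : T u = b *: u -> T (iter i Q u) = (b + i%:R * t) *: iter i Q u.
  elim: i => [|i IHi] Tu; first by rewrite mul0r addr0.
  rewrite iterS TQ IHi // linearZ -scalerDl; congr (_ *: _); rewrite -natr1; ring.
have [||||k k0] := @no_infinite_spectrum _ _ (fun u => h u = l *: u) T
    (fun k => a + (2 * k)%:R * t) (fun k => iter (2 * k) Q (iter k X v)).
- exact: swr_fin rep l.
- by move=> u hu; apply: hT.
- move=> i j /addrI/(mulIf t0)/eqP; rewrite eqr_nat => /eqP; lia.
- move=> k; split.
    by rewrite (hQi _ _ _ (hXi k _ _ hv)); congr (_ *: _); rewrite natrM; ring.
  by apply: TQi; rewrite (iter_comm _ _ TX) Tv linearZ.
by exists k; apply: (iter_inj_eq0 injQ k0).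
Qed.

(** The tensor product of q^y with a highest weight vector of the simple
    sl2-module of dimension n + 1, where dec_e and dec_f act on the second
    factor only. *)
Definition top_vector n y u :=
  [/\ u <> 0, dec_e u = 0, q (p u) = (c * y) *: u,
      h u = (n%:R - 2^-1 - y) *: u & iter n.+1 dec_f u = 0 /\ iter n dec_f u <> 0].

Lemma qp_p u : q (p (p u)) = p (q (p u)) + (- c) *: p u.
Proof. by rewrite pq scaleNr addrK. Qed.

Lemma qp_q u : q (p (q u)) = q (q (p u)) + c *: q u.
Proof. by rewrite pq linearD linearZ. Qed.

Lemma wt_qp m u : h u = m *: u -> h (q (p u)) = m *: q (p u).
Proof. by move=> /(wt_p rep)/(wt_q rep); rewrite addrK. Qed.

Lemma wt_dec_e m u : h u = m *: u -> h (dec_e u) = (m + 2 * 1) *: dec_e u.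
Proof.
move=> hu; rewrite dec_eE (linearB h) (linearZ_LR h) /= (wt_e rep hu).
rewrite (wt_p rep (wt_p rep hu)) scalerBr !scalerA mulr1 -addrA.
by rewrite [in RHS]mulrC.
Qed.

Lemma wt_dec_f m u : h u = m *: u -> h (dec_f u) = (m + 2 * (- 1)) *: dec_f u.
Proof.
move=> hu; rewrite dec_fE (linearD h) (linearZ_LR h) /= (wt_f rep hu).
rewrite (wt_q rep (wt_q rep hu)) scalerDr !scalerA mulrN1 -addrA.
rewrite [in RHS](mulrC _ (2 * c)^-1); congr (_ + _ *: _); congr (_ * _); ring.
Qed.

Lemma dec_h_eigen m y u : h u = m *: u -> q (p u) = (c * y) *: u ->
  dec_h u = (m + y + 2^-1) *: u.
Proof. by move=> hu Tu; rewrite dec_hE hu Tu scalerA mulKf // !scalerDl. Qed.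

(** Both dec_e and dec_f are nilpotent on a joint eigenvector of h and q p. A
    vector u killed by dec_e, with n maximal such that dec_f^n u <> 0, has
    dec_h-weight n, since dec_e dec_f^(n+1) u = 0; this fixes the h-weight. *)
Lemma exists_top_vector : exists n y u, top_vector n y u.
Proof.
have [l [v0 [hv0 v0N]]] : exists l v0, h v0 = l *: v0 /\ v0 <> 0.
  apply: contrapT => /forallNP wt0.
  case: (swr_simple rep) => [[v vN] _]; apply: vN; move: v.
  apply: (swr_span rep); first by split=> // k u v -> ->; rewrite scaler0 addr0.
  by move=> l v hv; apply: contrapT => vN; apply: (wt0 l); exists v.
have [|||a [v [hv vN Tv]]] := @exists_eigenvector _ _ (fun v => h v = l *: v)
    (q \o p : {linear V -> V}).
- exact: swr_fin rep l.
- by move=> u /wt_qp.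
- by exists v0.
rewrite /= in Tv.
have TE u : q (p (dec_e u)) = dec_e (q (p u)) by rewrite dec_e_q dec_e_p.
have TF u : q (p (dec_f u)) = dec_f (q (p u)) by rewrite dec_f_q dec_f_p.
have [|k [uN Eu]] := loc_nil_last (v := v) (X := dec_e) _ vN.
  apply: (@loc_nil_by_spectrum dec_e q (q \o p : {linear V -> V}) 1 c a l) => //.
  - exact: wt_dec_e.
  - exact: wt_q rep.
  - by move=> m u; apply: wt_qp.
  - exact: qp_q.
set u := iter k dec_e v in uN Eu *.
have Tu : q (p u) = a *: u.
  have := @iter_comm _ _ (q \o p : {linear V -> V}) dec_e k v TE.
  by rewrite /= Tv linearZ.
have [l' hu] : exists l', h u = l' *: u.
  rewrite /u; elim: k {uN Eu u Tu} => [|k [l' IHk]]; first by exists l.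
  by eexists; rewrite iterS (wt_dec_e IHk).
have [|n [uNn Fu]] := loc_nil_last (v := u) (X := dec_f) _ uN.
  apply: (@loc_nil_by_spectrum dec_f p (q \o p : {linear V -> V}) (- 1) (- c) a l') => //.
  - by rewrite oppr_eq0.
  - exact: wt_dec_f.
  - by move=> m w; rewrite opprK; exact: (wt_p rep).
  - by move=> m w; apply: wt_qp.
  - exact: qp_p.
have aE : a = c * (a / c) by rewrite mulrC divfK.
exists n, (a / c), u; split=> //; first by rewrite -aE.
have := sl2_lowering_top n dec_ef dec_hf (dec_h_eigen hu _) Eu.
move=> /(_ (a / c)); rewrite -aE => /(_ Tu).
rewrite iterS Fu linear0 => /esym/eqP; rewrite scaler_eq0 mulf_eq0 pnatr_eq0 /=.
case/orP => [/eqP ln|/eqP//]; rewrite hu; congr (_ *: _).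
rewrite -[n%:R](subrK (l' + a / c + 2^-1)) -opprB ln; ring.
Qed.

Lemma top_vector_q n y u : top_vector n (y + 1) (q u) <-> top_vector n y u.
Proof.
have q0 v : q v = 0 <-> v = 0 by split=> [/inj_q//|->]; rewrite linear0.
have qB v w : q v = q w <-> v = w.
  split=> [|->//] vw; apply/eqP; rewrite -subr_eq0; apply/eqP/inj_q.
  by rewrite linearB /= vw subrr.
have Fq k : iter k dec_f (q u) = q (iter k dec_f u).
  by rewrite (iter_comm (X := q)) // => v; rewrite dec_f_q.
have qpE : q (p (q u)) = (c * (y + 1)) *: q u <-> q (p u) = (c * y) *: u.
  rewrite qp_q mulrDr mulr1 scalerDl -!(linearZ_LR q).
  by split=> [/addIr/qB|->].
have hE : h (q u) = (n%:R - 2^-1 - (y + 1)) *: q u <->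
          h u = (n%:R - 2^-1 - y) *: u.
  rewrite (rep_hq rel) opprD addrA [in X in X <-> _]scalerBl scale1r -(linearZ_LR q).
  by split=> [/addIr/qB|->].
split=> [][uN Eu Tu hu [Fu FuN]].
  split; [by move/q0 | by apply/q0; rewrite -dec_e_q | exact/qpE | exact/hE |].
  by move: Fu FuN; rewrite !Fq !q0.
split; [by move/q0 | by rewrite dec_e_q Eu linear0 | exact/qpE | exact/hE |].
by rewrite !Fq !q0.
Qed.

Lemma q_surj v : exists w, v = q w.
Proof.
apply: (wt_span_surj rep) v => l v hv.
have [|||w _ ->] := @inj_endo_surj _ _ (fun v => h v = l *: v)
    (q \o p : {linear V -> V}) (swr_fin rep l) _ _ v.
- by move=> u; apply: wt_qp.
- by move=> u /= /inj_q/inj_p.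
- exact: hv.
by exists (p w).
Qed.

Lemma top_vector_chain n y u : top_vector n y u ->
  exists w : int -> V, [/\ w 0 = u, forall i, q (w i) = w (i + 1)
    & forall i : int, top_vector n (i%:~R + y) (w i)].
Proof.
move=> topu; have [g gE] := choice q_surj.
pose w (i : int) := match i with Posz k => iter k q u | Negz k => iter k.+1 g u end.
have qw i : q (w i) = w (i + 1).
  case: i => [k|[|k]]; first by rewrite -PoszD addn1.
    by rewrite /= -gE.
  have -> : Negz k.+1 + 1 = Negz k :> int by lia.
  by rewrite /w iterS -gE.
exists w; split=> // i; elim/int_rect: i => [|i IHi|i IHi].
- by rewrite add0r.
- have -> : Posz i.+1 = Posz i + 1 by lia.
  by rewrite -qw rmorphD /= addrAC; apply/top_vector_q.
- apply/top_vector_q; rewrite qw.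
  have -> : - i.+1%:Z + 1 = - i%:Z by lia.
  rewrite addrAC; have -> : 1 = 1%:~R :> K by [].
  by rewrite -rmorphD; have -> : - i.+1%:Z + 1 = - i%:Z by lia.
Qed.

Lemma exists_top_vector_shift n y u (k : int) : top_vector n y u ->
  exists u', top_vector n (y + k%:~R) u'.
Proof.
by move=> /top_vector_chain[w [_ _ wP]]; exists (w k); rewrite addrC.
Qed.

(** If y = 0, then q p u = 0, against the injectivity of p and q. *)
Lemma top_vector_neq0 n y u : top_vector n y u -> y != 0.
Proof.
move=> [uN _ Tu _ _]; apply/eqP => y0; apply: uN.
by apply/inj_p/inj_q; rewrite Tu y0 mulr0 scale0r.
Qed.

Section Chain.
Variables (n : nat) (y : K) (w : int -> V).
Hypothesis qw : forall i, q (w i) = w (i + 1).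
Hypothesis topw : forall i : int, top_vector n (i%:~R + y) (w i).

Let basis_vec (i : int) (j : nat) := iter j f (w i).

Lemma q_basis_vec i j : q (basis_vec i j) = basis_vec (i + 1) j.
Proof. by rewrite /basis_vec (iter_comm (X := q)) ?qw // => v; rewrite (rep_fq rel). Qed.

(** Checked after applying the injective q, since q p acts on w_i by a scalar. *)
Lemma p_chain i : p (w i) = (c * (i%:~R + y)) *: w (i - 1).
Proof.
apply/eqP; rewrite -subr_eq0; apply/eqP/inj_q.
rewrite linearB (linearZ_LR q) /= qw subrK.
by have [_ _ -> _ _] := topw i; rewrite subrr.
Qed.

Lemma h_basis_vec i j :
  h (basis_vec i j) = (n%:R - 2^-1 - (i%:~R + y) - 2 * j%:R) *: basis_vec i j.
Proof.
elim: j => [|j IHj]; first by rewrite mulr0 subr0; have [] := topw i.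
by rewrite /= (wt_f rep IHj); congr (_ *: _); rewrite -natr1; ring.
Qed.

Lemma p_basis_vec i j : p (basis_vec i j) =
  - j%:R *: basis_vec (i + 1) j.-1 + (c * (i%:~R + y)) *: basis_vec (i - 1) j.
Proof.
rewrite /basis_vec (iter_derivation (Z := fun v => - q v)).
- rewrite p_chain linearZ addrC scalerN -scaleNr.
  by rewrite -[iter j.-1 f (w i)]/(basis_vec _ _) q_basis_vec.
- exact: rep_pf rel.
- by move=> v; rewrite -(rep_fq rel) linearN.
Qed.

Lemma e_basis_vec i j : e (basis_vec i j) =
  (j%:R * (n%:R - 2^-1 + 1 - (i%:~R + y) - j%:R)) *: basis_vec i j.-1
  + (2^-1 * c * (i%:~R + y) * (i%:~R + y - 1)) *: basis_vec (i - 2) j.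
Proof.
have ew : e (w i) =
    (2^-1 * c * (i%:~R + y) * (i%:~R + y - 1)) *: w (i - 2).
  have [_ /eqP + _ _ _] := topw i; rewrite dec_eE subr_eq0 => /eqP ->.
  rewrite !p_chain (linearZ_LR p) p_chain !scalerA -addrA -opprD intrB.
  by rewrite -c2K; congr (_ *: w _); ring.
have [_ _ _ hw _] := topw i.
rewrite /basis_vec (sl2_lowering _ (rep_ef rel) (rep_hf rel) hw) ew linearZ addrC.
by congr (_ *: _ + _); ring.
Qed.

Lemma iter_q2_chain k (b : K) i :
  iter k (b \*: (q \o q)) (w i) = b ^+ k *: w (i + (2 * k)%N%:Z).
Proof.
elim: k => [|k IHk]; first by rewrite muln0 addr0 scale1r.
rewrite iterS IHk /= !linearZ /= !qw scalerA exprS.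
by congr (_ *: w _); [rewrite mulrC | lia].
Qed.

Lemma iter_dec_f_expand i m : iter m dec_f (w i) = \sum_(s < m.+1)
  (((2 * c)^-1) ^+ (m - s) * 'C(m, s)%:R) *: basis_vec (i + (2 * (m - s))%N%:Z) s.
Proof.
rewrite /dec_f iter_addf => [|v]; last by rewrite /= linearZ /= !(rep_fq rel).
by apply: eq_bigr => s _; rewrite iter_q2_chain linearZ /= scalerA mulrC.
Qed.

Lemma f_basis_vec_last i : f (basis_vec i n) = - \sum_(s < n.+1)
  (((2 * c) ^+ (n.+1 - s))^-1 * 'C(n.+1, s)%:R)
    *: basis_vec (i + (2 * (n.+1 - s))%N%:Z) s.
Proof.
have [_ _ _ _ [Fn _]] := topw i; move/eqP: Fn.
rewrite iter_dec_f_expand big_ord_recr /= subnn binn muln0 addr0 mul1r scale1r.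
rewrite addrC addr_eq0.
move=> /eqP ->; congr (- _); apply: eq_bigr => s _.
by rewrite exprVn.
Qed.

Lemma dec_e_ladder i k :
  dec_e (iter k.+1 dec_f (w i)) = (k.+1%:R * (n%:R - k%:R)) *: iter k dec_f (w i).
Proof.
have [_ Ew Tw hw _] := topw i.
rewrite (sl2_lowering_top _ dec_ef dec_hf (dec_h_eigen hw Tw) Ew).
by congr ((_ * (_ - _)) *: _); ring.
Qed.

(** f = dec_f - q^2 / 2c expands f^j w_i into dec_f^s w_i' with s <= j, where
    s = j occurs once. *)
Lemma iter_dec_e_basis_vec i j J : (j <= J <= n)%N ->
  iter J dec_e (basis_vec i j) =
  (if j == J then \prod_(k < J) (k.+1%:R * (n%:R - k%:R)) else 0) *: w i.
Proof.
move=> /andP[jJ Jn].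
have fE v : f v = (dec_f \+ (- (2 * c)^-1) \*: (q \o q)) v.
  by rewrite /= scaleNr addrK.
have -> : basis_vec i j = iter j (dec_f \+ (- (2 * c)^-1) \*: (q \o q)) (w i).
  by rewrite /basis_vec; apply: eq_iter.
rewrite iter_addf => [|v]; last by rewrite (linearZ_LR dec_f) /= -!dec_f_q.
rewrite linear_sum big_ord_recr /= subnn binn scale1r big1 ?add0r => [|s _].
  have [ <-|jNJ] := eqVneq j J; first exact: iter_ladder (dec_e_ladder i).
  have [_ Ew _ _ _] := topw i.
  by rewrite scale0r (iter_ladder_gt (dec_e_ladder i)) // ltn_neqAle jNJ.
rewrite iter_q2_chain !linearZ /= (iter_ladder_gt (dec_e_ladder _)) ?scaler0 //.
  by have [] := topw (i + (2 * (j - s))%N%:Z).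
exact: leq_trans (ltn_ord s) jJ.
Qed.

Lemma chain_indep (s : seq (int * 'I_n.+1)) (k : int * 'I_n.+1 -> K) j : uniq s ->
  (forall x, x \in s -> x.2 = j) ->
  \sum_(x <- s) k x *: w x.1 = 0 -> forall x, x \in s -> k x = 0.
Proof.
move=> us sj sum0 x xs.
have /eqP : k x *: w x.1 = 0.
  apply: (eigen_indep (T := h)
     (a := fun x => n%:R - 2^-1 - ((x.1)%:~R + y)) us _ _ sum0 xs).
    move=> [i1 j1] [i2 j2] /sj/= -> /sj/= -> /addrI/oppr_inj/addIr/eqP.
    by rewrite eqr_int => /eqP ->.
  move=> [i1 j1] _ /=; rewrite linearZ /=; have [_ _ _ -> _] := topw i1.
  by rewrite !scalerA mulrC.
by rewrite scaler_eq0 => /orP[/eqP//|/eqP]; have [] := topw x.1.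
Qed.

(** dec_e^J kills every f^j w_i with j < J and sends f^J w_i to a nonzero
    multiple of w_i, so the coefficients vanish layer by layer, largest j
    first. *)
Lemma basis_vec_indep (s : seq (int * 'I_n.+1)) (k : int * 'I_n.+1 -> K) : uniq s ->
  \sum_(x <- s) k x *: basis_vec x.1 x.2 = 0 -> forall x, x \in s -> k x = 0.
Proof.
move=> us sum0.
(* The layers with x.2 >= n + 1 - J, by induction on J. *)
suff below J : forall x, x \in s -> (n.+1 - J <= x.2)%N -> k x = 0.
  by move=> x xs; apply: (below n.+1); rewrite ?subnn.
elim: J => [|J IHJ] x xs; first by rewrite subn0 leqNgt ltn_ord.
have [nJ|Jn'] := leqP n.+1 J.
  by move=> _; apply: IHJ => //; rewrite (eqP nJ).
rewrite leq_eqVlt => /predU1P[xJ|]; last first.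
  by rewrite subnSK //; apply: IHJ.
have JJ : (n.+1 - J.+1 <= n)%N by rewrite subSS leq_subr.
pose m := (n.+1 - J.+1)%N; rewrite -/m in xJ JJ.
have := congr1 (iter m dec_e) sum0; rewrite linear0 linear_sum.
rewrite (bigID (fun z : int * 'I_n.+1 => z.2 == x.2)) /=.
rewrite [X in _ + X]big1_seq ?addr0 => [|z /andP[zx zs]]; last first.
  rewrite linearZ /=; have [zm|mz] := leqP z.2 m.
    rewrite iter_dec_e_basis_vec ?zm //.
    case: eqP => [zE|]; last by rewrite scale0r scaler0.
    by case/eqP: zx; apply: val_inj; rewrite /= zE.
  by rewrite (IHJ z zs) ?scale0r //; rewrite /m subnSK in mz.
rewrite (eq_bigr (fun z => (k z * \prod_(k < m) (k.+1%:R * (n%:R - k%:R))) *: w z.1)).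
  rewrite -big_filter => layer0.
  have /eqP : k x * \prod_(k < m) (k.+1%:R * (n%:R - k%:R)) = 0.
    apply: (chain_indep (j := x.2) (filter_uniq _ us) _ layer0) => [z|].
      by rewrite mem_filter => /andP[/eqP].
    by rewrite mem_filter eqxx.
  rewrite mulf_eq0 => /orP[/eqP//|]; rewrite prodf_seq_eq0 => /hasP[i _ /=].
  rewrite mulf_eq0 pnatr_eq0 subr_eq0 eqr_nat /= => /eqP nE.
  by have := ltn_ord i; rewrite -nE ltnNge JJ.
move=> z /eqP zx; rewrite linearZ /= zx -xJ iter_dec_e_basis_vec ?leqnn // eqxx scalerA.
by [].
Qed.

(** The formulas above say that the span is a submodule. *)
Lemma basis_vec_span v : lin_span (fun x : int * 'I_n.+1 => basis_vec x.1 x.2) v.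
Proof.
set b := fun x : int * 'I_n.+1 => _.
have bW i j : (j <= n)%N -> lin_span b (basis_vec i j).
  by rewrite -ltnS => jn; apply: (lin_span_gen b (i, Ordinal jn)).
have jn (x : int * 'I_n.+1) : (x.2 <= n)%N by rewrite -ltnS.
have j1n (x : int * 'I_n.+1) : (x.2.-1 <= n)%N by apply: leq_trans (leq_pred _) _.
case: (swr_simple rep) => _ /(_ _ (lin_span_subspace b)).
case=> [u bu|b0|//]; last first.
  by have [w0 _ _ _ _] := topw 0; case: w0; apply/b0/(bW 0 0%N).
split; apply: (lin_span_stable _ bu) => x.
- rewrite /b e_basis_vec; apply: lin_spanD; apply: lin_spanZ; exact: bW.
- have [xn|nx] := ltnP x.2 n; first by apply: (bW x.1 x.2.+1).
  have -> : b x = basis_vec x.1 n by rewrite /b; congr basis_vec; apply/eqP; rewrite eqn_leq jn.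
  rewrite f_basis_vec_last -scaleN1r; apply/lin_spanZ/lin_span_sum => s.
  by apply/lin_spanZ/bW; rewrite -ltnS.
- by rewrite /b h_basis_vec; apply/lin_spanZ/bW.
- rewrite /b p_basis_vec; apply: lin_spanD; apply: lin_spanZ; exact: bW.
- by rewrite /b q_basis_vec; apply: bW.
Qed.

Lemma basis_vec_basis : is_basis (fun x : int * 'I_n.+1 => basis_vec x.1 x.2).
Proof.
split=> [v|s k]; last exact: basis_vec_indep.
by have [s [k [_ ->]]] := basis_vec_span v; exists s, k.
Qed.

End Chain.

Lemma top_vector_Bq n y u : top_vector n y u ->
  exists v : int -> nat -> V,
    is_basis (fun ij : int * 'I_n.+1 => v ij.1 ij.2) /\
    forall (i : int) (j : nat), (j <= n)%N ->
    let l := n%:R - 2^-1 in let yi := i%:~R + y in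
    [/\ q (v i j) = v (i + 1) j &
        f (v i j) =
          (if (j < n)%N then v i j.+1
           else - \sum_(s < n.+1)
                    (((2 * c) ^+ (n.+1 - s))^-1 * 'C(n.+1, s)%:R)
                      *: v (i + (2 * (n.+1 - s))%N%:Z) s)] /\
    [/\ h (v i j) = (l - yi - 2 * j%:R) *: v i j,
        p (v i j) = - j%:R *: v (i + 1) j.-1 + (c * yi) *: v (i - 1) j
      & e (v i j) = (j%:R * (l + 1 - yi - j%:R)) *: v i j.-1
          + (2^-1 * c * yi * (yi - 1)) *: v (i - 2) j].
Proof.
move=> /top_vector_chain[w [_ qw topw]].
exists (fun i j => iter j f (w i)); split; first exact: basis_vec_basis qw topw.
move=> i j jn l yi; split; split.
- exact: q_basis_vec qw i j.
- case: ltnP => // nj; have -> : j = n by apply/eqP; rewrite eqn_leq jn.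
  exact: f_basis_vec_last qw topw i.
- exact: h_basis_vec topw i j.
- exact: p_basis_vec qw topw i j.
- exact: e_basis_vec qw topw i j.
Qed.

End Charged.

(** * Central charge zero *)

Section Uncharged.
Variables (K : numClosedFieldType) (V : lmodType K).
Variables (e f h p q : {linear V -> V}).
Hypothesis rep : simple_weight_rep e f h p q 0.
Let rel := swr_rep rep.

(** The joint kernel of p and q is a submodule. *)
Lemma pq_zero : (forall v, loc_nil p v) -> (forall v, loc_nil q v) ->
  forall v, p v = 0 /\ q v = 0.
Proof.
move=> pnil qnil.
have pq v : p (q v) = q (p v) by rewrite (rep_pq rel) scale0r addr0.
have [[v0 v0N] sV] := swr_simple rep.
have [k [uN pu]] := loc_nil_last (pnil v0) v0N.
have [j [xN qx]] := loc_nil_last (qnil _) uN.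
have [] := sV (fun v => p v = 0 /\ q v = 0).
- split=> [|a u v [pu' qu] [pv qv]]; first by rewrite !linear0.
  by rewrite !linearP /= pu' qu pv qv scaler0 addr0.
- move=> v [pv qv]; split; split; rewrite ?pv ?qv ?linear0 //.
  + by rewrite -(rep_ep rel) pv linear0.
  + by apply: (addIr (p v)); rewrite -(rep_eq rel) qv pv linear0 add0r.
  + by rewrite (rep_pf rel) pv qv linear0 subr0.
  + by rewrite -(rep_fq rel) qv linear0.
  + by apply: (addIr (p v)); rewrite -(rep_hp rel) pv linear0 add0r.
  + by apply: (addIr (- q v)); rewrite -(rep_hq rel) qv linear0 oppr0 add0r.
- move/(_ _ (conj _ qx)) => x0; case: xN; apply: x0.
  by rewrite (iter_comm _ _ pq) pu linear0.
- by [].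
Qed.

(** The product of the h - l over the l in s. A product of shifted copies of h
    tracks which weights a vector may involve, without decomposing the vector. *)
Fixpoint annihilator (s : seq K) : {linear V -> V} :=
  if s is l :: s' then (h \- l \*: idfun) \o annihilator s' else idfun.

Lemma annihilator_comm s v : annihilator s (h v) = h (annihilator s v).
Proof. by elim: s => //= l s ->; rewrite (linearB h) (linearZ_LR h). Qed.

Lemma annihilator_cat s t v :
  annihilator (s ++ t) v = annihilator s (annihilator t v).
Proof. by elim: s => //= l s ->. Qed.

Lemma annihilatorC s t v :
  annihilator s (annihilator t v) = annihilator t (annihilator s v).
Proof.
elim: t => //= l t IHt.
by rewrite (linearB (annihilator s)) (linearZ_LR (annihilator s)) annihilator_comm IHt.
Qed.

Lemma annihilator_shift (X : {linear V -> V}) (r : K) s v :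
  (forall v, h (X v) = X (h v) + r *: X v) ->
  annihilator [seq l + r | l <- s] (X v) = X (annihilator s v).
Proof.
move=> hX; elim: s => //= l s ->; rewrite hX (linearB X) (linearZ_LR X) scalerDl.
by rewrite opprD addrACA subrr addr0.
Qed.

Lemma annihilator_eigen s l v :
  h v = l *: v -> annihilator s v = (\prod_(m <- s) (l - m)) *: v.
Proof.
move=> hv; elim: s => [|m s IHs] /=; first by rewrite big_nil scale1r.
rewrite IHs (linearZ_LR h) hv big_cons !scalerA -scalerBl; congr (_ *: _); ring.
Qed.

(** Vectors annihilated by some product of h - l with all l in S form a
    submodule, because e and f shift S into itself. *)
Lemma weights_in_coset (S : K -> Prop) mu v0 :
  (forall v, p v = 0 /\ q v = 0) ->
  (forall l, S l -> S (l + 2)) -> (forall l, S l -> S (l - 2)) ->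
  S mu -> h v0 = mu *: v0 -> v0 <> 0 ->
  forall l v, h v = l *: v -> v <> 0 -> S l.
Proof.
move=> pq0 Se Sf Smu hv0 v0N l v hv vN.
pose W u := exists s : seq K, (forall l, l \in s -> S l) /\ annihilator s u = 0.
have shiftW (X : {linear V -> V}) r : (forall v, h (X v) = X (h v) + r *: X v) ->
    (forall l, S l -> S (l + r)) -> forall u, W u -> W (X u).
  move=> hX SX u [s [sS su]]; exists [seq l + r | l <- s]; split.
    by move=> _ /mapP[m /sS/SX Sm ->].
  by rewrite annihilator_shift // su linear0.
have W0 : W 0 by exists [::]; rewrite linear0.
have [_ sV] := swr_simple rep; have [||WV|WV] := sV W.
- split=> // k u1 u2 [s1 [S1 su1]] [s2 [S2 su2]]; exists (s1 ++ s2); split.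
    by move=> m; rewrite mem_cat => /orP[/S1|/S2].
  rewrite annihilator_cat !linearP /= su2 linear0 annihilatorC su1 linear0.
  by rewrite scaler0 addr0.
- move=> u Wu; have [-> ->] := pq0 u; split=> //.
  + exact: (shiftW e 2 (rep_he rel) Se).
  + apply: (shiftW f (- 2) _ Sf) => // x.
    by rewrite (rep_hf rel) scaleNr.
  + have [s [sS su]] := Wu; exists s; split=> //.
    by rewrite annihilator_comm su linear0.
- case: v0N; apply: WV; exists [:: mu]; split=> [m|/=].
    by rewrite inE => /eqP ->.
  by rewrite hv0 subrr.
have [s [sS]] := WV v; rewrite (annihilator_eigen _ hv) => /eqP.
rewrite scaler_eq0 => /orP[|/eqP//]; rewrite prodf_seq_eq0 => /hasP[m ms /=].
by rewrite subr_eq0 => /eqP ->; apply: sS.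
Qed.

End Uncharged.

(** * Passage from modules over the Schroedinger algebra *)

Section Module.
Variables (R : realType) (V : lmodType R[i]) (act : schr R -> V -> V).
Hypothesis HU : is_Umodule act.
Hypothesis Hsimple : is_simple act.
Hypothesis Hweight : is_weight_module act.
Hypothesis Hfin : has_fin_dim_weight_spaces act.

Lemma act_is_linear a : linear (act a). Proof. by have [] := HU. Qed.

HB.instance Definition _ a :=
  GRing.isLinear.Build R[i] V V *:%R (act a) (act_is_linear a).

Lemma act_comm a b v : act a (act b v) = act b (act a v) + act [< a, b >] v.
Proof. by have [_ _ ->] := HU; rewrite addrC subrK. Qed.

Lemma act_left_linear v k a b : act (k *: a + b) v = k *: act a v + act b v.
Proof. by have [_ /(_ v) -> _] := HU. Qed.

Lemma act0l v : act 0 v = 0.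
Proof. by have := act_left_linear v (- 1) 0 0; rewrite !scaler0 addr0 scaleN1r addNr. Qed.

Lemma actZl k a v : act (k *: a) v = k *: act a v.
Proof. by rewrite -[k *: a]addr0 act_left_linear act0l addr0. Qed.

Lemma actNl a v : act (- a) v = - act a v.
Proof. by rewrite -[- a]scaleN1r actZl scaleN1r. Qed.

Lemma act_basis a v : act a v =
  cf a *: act (sf R) v + (cq a *: act (sq R) v + (ch a *: act (sh R) v +
  (cz a *: act (sz R) v + (cp a *: act (sp R) v + ce a *: act (se R) v)))).
Proof.
rewrite -[ce a *: _]actZl -!act_left_linear; congr (act _ v).
apply/rowP; case=> [[|[|[|[|[|[|//]]]]]] ltk];
  rewrite /cf /cq /ch /cz /cp /ce !mxE /=
    !(mulr0, mulr1, add0r, addr0); congr (a _ _); exact: val_inj.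
Qed.

(** V is a sum of z-eigenspaces and each of them is a submodule. *)
Lemma z_scalar : exists c : R[i], forall v, act (sz R) v = c *: v.
Proof.
have [_ [_ z_central]] := schr_table R.
have zC a v : act (sz R) (act a v) = act a (act (sz R) v).
  by rewrite act_comm z_central act0l addr0.
have [[v vN] sV] := Hsimple.
have [s [w [_ wW vE]]] := Hweight.1 v.
have [i wiN] : exists i, w i <> 0.
  apply: contrapT => /forallNP w0; case/eqP: vN; rewrite vE big1 // => i _.
  by apply: contrapT => /w0.
exists i.2; have [|W0|WT] := sV [set v | act (sz R) v = i.2 *: v]%classic.
- split=> /= [|k x y zx zy|a x zx].
  + by rewrite linear0 scaler0.
  + by rewrite linearP /= zx zy scalerDr !scalerA mulrC.
  + by rewrite zC zx linearZ.
- by case: wiN; have : [set 0]%classic (w i) by rewrite -W0; case: (wW i).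
by move=> x; have : [set: V]%classic x by []; rewrite -WT.
Qed.

Lemma module_rep c : (forall v, act (sz R) v = c *: v) ->
  simple_weight_rep (act (se R)) (act (sf R)) (act (sh R)) (act (sp R))
    (act (sq R)) c.
Proof.
move=> zE.
have [[Bhe Bhp Bhf Beq Bep] [[Bef Bpf Bfq Bhq Bpq] _]] := schr_table R.
split.
- split=> v /=; rewrite act_comm ?Bhe ?Bhp ?Bhf ?Beq ?Bep ?Bef ?Bpf ?Bfq ?Bhq ?Bpq;
  by rewrite ?actZl ?actNl ?act0l ?addr0 ?scaleNr ?zE.
- have [[v vN] sV] := Hsimple; split=> [|W [W0 Wlin] WV].
    by exists v; apply/eqP.
  have WZ k u : W u -> W (k *: u) by move=> Wu; rewrite -[_ *: _]addr0; apply: Wlin.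
  have [|W1|WT] := sV W; last by right=> u; rewrite WT.
    split=> // a u Wu; have [We Wf Wh Wp Wq] := WV _ Wu; rewrite act_basis.
    do 4?[apply: (Wlin) => //]; first by rewrite zE; apply: WZ.
    by apply: Wlin => //; apply: WZ.
  by left=> u; rewrite W1.
- move=> W [W0 Wlin] wtW v; have [s [w [_ wW ->]]] := Hweight.1 v.
  apply: (big_ind W) => // [x y Wx Wy|i _]; first by rewrite -[x]scale1r; apply: Wlin.
  by apply: (wtW i.1); case: (wW i).
- move=> l; apply: fin_dim_coord.
    split=> [|k u v hu hv]; first by rewrite linear0 scaler0.
    by rewrite linearP /= hu hv scalerDr !scalerA mulrC.
  have [m [b [bW span_b]]] := Hfin (l, c); exists m, b; split=> [i|v hv].
    by case: (bW i).
  by apply: span_b.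
Qed.

Lemma generated_by_neq0 v : v <> 0 -> generated_by act v.
Proof.
move=> vN W sW Wv; have [_ sV] := Hsimple.
by have [W0|//] := sV W sW; case: vN; move: Wv; rewrite W0.
Qed.

Lemma exists_weight : exists l v, act (sh R) v = l *: v /\ v <> 0.
Proof.
have [[v vN] _] := Hsimple; have [s [w [_ wW vE]]] := Hweight.1 v.
apply: contrapT => /forallNP nw; case/eqP: vN; rewrite vE big1 // => i _.
apply: contrapT => wiN; apply: (nw i.1); exists (w i); split=> //.
by case: (wW i).
Qed.

Lemma highest_weight_of_bounded l :
  supp act l ->
  (exists m, forall j, (m <= j)%N ->
     forall v, act (sh R) v = (l + j%:R) *: v -> v = 0) ->
  is_highest_weight_module act.
Proof.
move=> suppl [m mP].
have ex0 : exists j, `[< supp act (l + j%:R) >].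
  by exists 0%N; apply/asboolP; rewrite addr0.
have bound j : `[< supp act (l + j%:R) >] -> (j <= m)%N.
  move=> /asboolP[v [/eqP vN hv]]; rewrite leqNgt; apply/negP => /ltnW mj.
  exact/vN/(mP j mj).
case: (ex_maxnP ex0 bound) => j /asboolP suppj jmax.
have [v [/eqP vN hv]] := suppj.
exists (l + j%:R), v; split=> //; last exact: generated_by_neq0.
split=> // m' suppm' [k /eqP]; rewrite subr_eq => /eqP m'E.
have /jmax : `[< supp act (l + (k + j)%:R) >].
  by apply/asboolP; rewrite natrD addrCA -m'E.
by rewrite -{2}[j]add0n leq_add2r leqn0 m'E => /eqP ->; rewrite add0r.
Qed.

Lemma lowest_weight_of_bounded l :
  supp act l ->
  (exists m, forall j, (m <= j)%N ->
     forall v, - act (sh R) v = (- l + j%:R) *: v -> v = 0) ->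
  is_lowest_weight_module act.
Proof.
move=> suppl [m mP].
have ex0 : exists j, `[< supp act (l - j%:R) >].
  by exists 0%N; apply/asboolP; rewrite subr0.
have bound j : `[< supp act (l - j%:R) >] -> (j <= m)%N.
  move=> /asboolP[v [/eqP vN hv]]; rewrite leqNgt; apply/negP => /ltnW mj.
  by apply/vN/(mP j mj); rewrite hv -scaleNr opprB addrC.
case: (ex_maxnP ex0 bound) => j /asboolP suppj jmax.
have [v [/eqP vN hv]] := suppj.
exists (l - j%:R), v; split=> //; last exact: generated_by_neq0.
split=> // m' suppm' [k /eqP]; rewrite subr_eq => /eqP m'E.
have /jmax : `[< supp act (l - (k + j)%:R) >].
  by apply/asboolP; rewrite natrD opprD addrCA m'E addKr.
by rewrite -{2}[j]add0n leq_add2r leqn0 m'E => /eqP ->; rewrite add0r.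
Qed.

Lemma dense_of_injective : 
  (forall v, act (se R) v = 0 -> v = 0) -> (forall v, act (sf R) v = 0 -> v = 0) ->
  (forall v, act (sp R) v = 0 /\ act (sq R) v = 0) ->
  simple_weight_rep (act (se R)) (act (sf R)) (act (sh R)) (act (sp R))
    (act (sq R)) 0 ->
  is_dense_sl2_module act.
Proof.
move=> inj_e inj_f pq0 rep; split=> //.
have [mu [v0 [hv0 v0N]]] := exists_weight; exists mu.
rewrite predeqE => l; split=> [[v [/eqP vN hv]]|[k _ <-]].
- pose S (l : R[i]) := [set mu + 2 * k%:~R | k in [set: int]]%classic l.
  apply: (weights_in_coset (S := S) rep pq0 _ _ _ hv0 v0N hv vN).
  + by move=> _ [k _ <-]; exists (k + 1) => //; rewrite intrD; ring.
  + by move=> _ [k _ <-]; exists (k - 1) => //; rewrite intrB; ring.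
  + by exists 0 => //; rewrite mulr0 addr0.
- have step (X : {linear V -> V}) (r : R[i]) m : (forall v, X v = 0 -> v = 0) ->
      (forall l v, act (sh R) v = l *: v -> act (sh R) (X v) = (l + r) *: X v) ->
      supp act (mu + m%:R * r).
    move=> injX hX; exists (iter m X v0); split.
      by apply/eqP => /(iter_inj_eq0 injX).
    elim: m => [|m IHm]; first by rewrite /h_space /= mul0r addr0.
    by rewrite /h_space /= (hX _ _ IHm) -natr1; congr (_ *: _); ring.
  case: k => k.
    by rewrite mulrC; apply: (step (act (se R))) => // l' v; apply: (wt_e rep).
  rewrite NegzE intrN mulrN -mulNr mulrC.
  by apply: (step (act (sf R))) => // l' v; apply: (wt_f rep).
Qed.

(** Moving the top vector by a power of q changes y by an integer, which brings
    the real part of the exponent into [0, 1). *)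
Lemma Bq_of_injective c : c != 0 ->
  (forall v, act (sz R) v = c *: v) ->
  simple_weight_rep (act (se R)) (act (sf R)) (act (sh R)) (act (sp R))
    (act (sq R)) c ->
  (forall v, act (sp R) v = 0 -> v = 0) -> (forall v, act (sq R) v = 0 -> v = 0) ->
  exists (n : nat) (c x : R[i]),
     [/\ c != 0, x != 0, 0 <= complex.Re x < 1 & is_Bq act n c x].
Proof.
move=> c0 zE rep inj_p inj_q.
have [n [y [u topu]]] := exists_top_vector rep c0 inj_p inj_q.
have [u' topu'] := exists_top_vector_shift rep c0 inj_p inj_q
  (- Num.floor (complex.Re y)) topu.
set x := y + _ in topu'.
exists n, c, x; split=> //; first exact: top_vector_neq0 inj_p inj_q _ _ _ topu'.
  have -> : complex.Re x = complex.Re y - (Num.floor (complex.Re y))%:~R.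
    rewrite /x intrN -(rmorph_int (real_complex R)).
    by case: y {topu x topu'} => a b.
  rewrite subr_ge0 floor_le ltrBlDl.
  by have := floorD1_gt (complex.Re y); rewrite intrD.
have [v [vB vE]] := top_vector_Bq rep c0 inj_p inj_q topu'.
exists v; split=> // i j jn; have [[qE fE] [hE pE eE]] := vE i j jn.
by split.
Qed.

End Module.

Theorem corollary6 (R : realType) (V : lmodType R[i])
    (act : schr R -> V -> V) (HU : is_Umodule act) (Hsimple : is_simple act)
    (Hweight : is_weight_module act)
    (Hfin : has_fin_dim_weight_spaces act) :
  is_dense_sl2_module act \/
  is_highest_weight_module act \/
  is_lowest_weight_module act \/
  (exists (n : nat) (c x : R[i]),
     [/\ c != 0, x != 0, 0 <= complex.Re x < 1 & is_Bq act n c x]).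
Proof.
have [c zE] := z_scalar HU Hsimple Hweight.
have rep := module_rep HU Hsimple Hweight Hfin zE.
have rep' := swr_swap rep.
have [l [v [hv vN]]] := exists_weight Hsimple Hweight.
have suppl : supp act l by exists v; split=> //; apply/eqP.
have [inj_e|enil] := dichotomy_e rep; last first.
  right; left; apply: (highest_weight_of_bounded Hsimple suppl).
  exact: bounded_of_loc_nil_e rep l enil.
have [inj_f|fnil] := dichotomy_e rep'; last first.
  right; right; left; apply: (lowest_weight_of_bounded Hsimple suppl).
  exact: bounded_of_loc_nil_e rep' (- l) fnil.
have [c0|c0] := eqVneq c 0.
  left; have pnil := loc_nil_p rep c0 inj_e inj_f.
  have qnil : forall v, loc_nil (act (sq R)) v.
    by apply: (loc_nil_p rep'); rewrite ?c0 ?oppr0.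
  rewrite c0 in rep.
  exact: dense_of_injective inj_e inj_f (pq_zero rep pnil qnil) rep.
have [inj_p|pnil] := dichotomy_p rep; last first.
  right; left; apply: (highest_weight_of_bounded Hsimple suppl).
  exact: bounded_of_loc_nil_p rep l c0 pnil.
have [inj_q|qnil] := dichotomy_p rep'; last first.
  right; right; left; apply: (lowest_weight_of_bounded Hsimple suppl).
  by apply: (bounded_of_loc_nil_p rep' (- l) _ qnil); rewrite oppr_eq0.
by right; right; right; apply: (Bq_of_injective c0 zE rep inj_p inj_q).
Qed.
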